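(* For every tree $\Upsilon$ the space $C_0(\Upsilon)$ admits $C^\infty$ partitions of unity: for every open cover $\mathcal{U}$ of $C_0(\Upsilon)$ there is a locally finite partition of unity consisting of infinitely Fréchet differentiable functions, subordinate to $\mathcal{U}$.
   Context: A tree is a partially ordered set $(\Upsilon,\preceq)$ such that for each $t\in\Upsilon$ the set $\{s: s\preceq t\}$ is well-ordered by $\preceq$; write $(0,t]=\{s:s\preceq t\}$, $(0,t)=\{s:s\prec t\}$, and let $r(t)$ be the order type of $(0,t)$. Trees are assumed Hausdorff: if $r(t)$ is a limit ordinal and $(0,t)=(0,t')$ then $t=t'$. $\Upsilon$ carries the coarsest topology in which every $(0,t]$ is open and closed. $C_0(\Upsilon)$ is the Banach space of continuous $f:\Upsilon\to\mathbb{R}$ such that $\{t:|f(t)|\ge\epsilon\}$ is compact for all $\epsilon>0$, with the supremum norm. *)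

(* Defs.v *)
From HB Require Import structures.
From mathcomp Require Import all_boot all_algebra.
From mathcomp Require Import all_classical all_reals all_analysis.
Import GRing.Theory Num.Theory.
Set Implicit Arguments. Unset Strict Implicit. Unset Printing Implicit Defensive.
Local Open Scope ring_scope.
Local Open Scope classical_set_scope.

Definition tlt {T : Type} (le : T -> T -> Prop) (s t : T) : Prop :=
  le s t /\ s <> t.

(* r(t) is a limit ordinal: (0,t) is nonempty and has no greatest element *)
Definition tree_limit {T : Type} (le : T -> T -> Prop) (t : T) : Prop :=
  (exists s, tlt le s t) /\
  ~ (exists m, tlt le m t /\ forall s, tlt le s t -> le s m).

Definition is_tree {T : Type} (le : T -> T -> Prop) : Prop :=
  [/\ (forall t, le t t),
      (forall s t, le s t -> le t s -> s = t),
      (forall r s t, le r s -> le s t -> le r t),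
      (forall t (A : set T), A `<=` [set s | le s t] -> A !=set0 ->
          exists2 m, A m & forall a, A a -> le m a) &
      (forall t t', tree_limit le t ->
          (forall s, tlt le s t <-> tlt le s t') -> t = t')].

(* The tree carrying its topology: coarsest topology in which every (0,t]
   is open and closed, i.e. generated by the subbase of the sets (0,t]
   and their complements. *)
Definition tree_top (T : choiceType) (le : T -> T -> Prop) : Type := T.

HB.instance Definition _ (T : choiceType) (le : T -> T -> Prop) :=
  Choice.on (tree_top le).

Definition tree_subbase (T : choiceType) (le : T -> T -> Prop)
  (i : option (bool * T)) : set (tree_top le) :=
  match i with
  | None => setT
  | Some (true, t) => [set s | le s t]
  | Some (false, t) => ~` [set s | le s t]
  end.

HB.instance Definition _ (T : choiceType) (le : T -> T -> Prop) :=
  isSubBaseTopological.Build (tree_top le) setT (@tree_subbase T le).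

Definition C0 (R : realType) (T : choiceType) (le : T -> T -> Prop) :
    set (tree_top le -> R) :=
  [set f | continuous f /\
           forall e : R, 0 < e -> compact [set t | e <= `|f t|]].

Definition supnorm (R : realType) (T : choiceType) (le : T -> T -> Prop)
  (f : tree_top le -> R) : R := sup (range (fun t => `|f t|)).

(* Normed-space notions, for a normed space given as a linear subspace  *)
(* S of an lmodType E with norm nrm.                                    *)

Definition nopen (R : realType) (E : lmodType R) (S : set E) (nrm : E -> R)
  (U : set E) : Prop :=
  U `<=` S /\
  forall x, U x -> exists2 r : R, 0 < r &
    forall y, S y -> nrm (y - x) < r -> U y.

Definition nclosure (R : realType) (E : lmodType R) (S : set E) (nrm : E -> R)
  (A : set E) : set E :=
  [set x | S x /\ forall r : R, 0 < r -> exists2 y, A y & nrm (y - x) < r].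

Definition bounded_multilinear (R : realType) (E : lmodType R) (S : set E)
  (nrm : E -> R) (k : nat) (L : seq E -> R) : Prop :=
  (forall (hs : seq E) (i : nat) (a : R) (u v : E),
     size hs = k -> (i < k)%N -> (forall w, w \in hs -> S w) -> S u -> S v ->
     L (set_nth 0 hs i (a *: u + v)) =
       a * L (set_nth 0 hs i u) + L (set_nth 0 hs i v)) /\
  exists M : R, forall hs : seq E, size hs = k -> (forall w, w \in hs -> S w) ->
     `|L hs| <= M * \prod_(w <- hs) nrm w.

(* phi is infinitely Frechet differentiable on the normed space (S, nrm):
   D k x is the k-th Frechet derivative of phi at x (a bounded k-linear form),
   D 0 x = phi x, and x |-> D k x is Frechet differentiable, in operator norm,
   with derivative h |-> D (k+1) x (h :: _). *)
Definition smooth_on (R : realType) (E : lmodType R) (S : set E) (nrm : E -> R)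
  (phi : E -> R) : Prop :=
  exists D : nat -> E -> seq E -> R,
  [/\ (forall x, S x -> D 0%N x [::] = phi x),
      (forall k x, S x -> bounded_multilinear S nrm k (D k x)) &
      (forall k x, S x -> forall e : R, 0 < e -> exists2 d : R, 0 < d &
         forall h, S h -> nrm h < d ->
         forall hs : seq E, size hs = k ->
           (forall w, w \in hs -> S w /\ nrm w <= 1) ->
           `|D k (x + h) hs - D k x hs - D k.+1 x (h :: hs)| <= e * nrm h)].

Definition smooth_pou_subordinate (R : realType) (E : lmodType R) (S : set E)
  (nrm : E -> R) (UU : set (set E)) (J : choiceType) (phi : J -> E -> R) : Prop :=
  [/\ (forall j, smooth_on S nrm (phi j)),
      (forall j x, S x -> 0 <= phi j x),
      (forall x, S x -> exists2 r : R, 0 < r &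
         finite_set [set j | exists2 y, S y /\ nrm (y - x) < r & phi j y != 0]),
      (forall x, S x -> \sum_(j \in [set j | phi j x != 0]) phi j x = 1) &
      (forall j, exists2 U, UU U &
         nclosure S nrm [set y | S y /\ phi j y != 0] `<=` U)].

(* Main.v *)
Require Import Defs.
From HB Require Import structures.
From mathcomp Require Import all_boot all_order all_algebra.
From mathcomp Require Import finmap all_classical all_reals all_analysis.
From mathcomp Require Import ring lra.
Import Order.TTheory GRing.Theory Num.Theory.
Import numFieldNormedType.Exports.
Set Implicit Arguments. Unset Strict Implicit. Unset Printing Implicit Defensive.
Local Open Scope ring_scope.
Local Open Scope classical_set_scope.

(* Every function used below agrees, near each point of C_0, with an elementary
   expression in finitely many evaluations f |-> f t; such a function is smooth.

   For a rational window (center q, radius r, |q| >= 4 r) and t in the tree, the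
   function f |-> alpha (f t) * prod_(s immediate successor of t) kappa (f s)
   detects that f t is close to q while f s is not, for every s. The product is
   locally finite because f is small at almost all successors of t, and the
   family of these detectors, indexed by t, is locally finite because f has
   finitely many jumps of a given size on each (0, t] and {|f| >= e} is covered
   by finitely many (0, t]. A second locally finite family detects pairs (t, s)
   with s a successor of t where f jumps to a nonzero value.

   Whenever f x <> 0, some u >= x with f constant on [x, u] is detected as the
   end of a level. Applied to all windows, with thresholds on |f t| increasing
   to 1, this gives a bump function. Moreover each x with f x <> 0 lies in an
   interval (t, u] with detected ends on which f is almost constant, so f is
   approximated by step functions that are detected by products of detectors.
   These products, multiplied by translated and scaled bumps, form a sigma-locally
   finite family of smooth functions whose supports refine the cover; the usual
   shrinking argument makes it locally finite, and one normalizes. *)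

(** * A flat function and a smooth step on the line *)

Section RealFunctions.
Variable R : realType.

(** Differentiability without a quotient, in the form that combines directly with [fdiff] in the
    chain rule. *)
Definition rderiv (g : R -> R) (u a : R) : Prop :=
  forall e, 0 < e -> exists2 d, 0 < d &
    forall s, `|s| < d -> `|g (u + s) - g u - a * s| <= e * `|s|.

Lemma rderiv_is_derive (g : R -> R) (u a : R) :
  is_derive u 1 g a -> rderiv g u a.
Proof.
move=> -[dg <-] e e0.
have /cvgrPdist_le /(_ e e0) := dg.
rewrite near_withinE => /nbhs_ballP[d /= d0 dP].
exists d => // s sd.
have [->|s0] := eqVneq s 0; first by rewrite addr0 mulr0 subr0 subrr normr0 mulr0.
have := dP s; rewrite /ball /= sub0r normrN => /(_ sd s0).
rewrite /derive /= scaler1 [s + u]addrC.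
set L := lim _ => H.
have -> : g (u + s) - g u - L * s = - ((L - s^-1 *: (g (u + s) - g u)) * s).
  by rewrite mulrBl /GRing.scale /= mulrAC mulVf// mul1r; ring.
by rewrite normrN normrM ler_wpM2r.
Qed.

Lemma rderiv_near (f g : R -> R) (u a : R) (r : R) : 0 < r ->
  (forall s, `|s| < r -> f (u + s) = g (u + s)) -> rderiv f u a -> rderiv g u a.
Proof.
move=> r0 fg df e e0; have [d d0 dP] := df e e0.
exists (Num.min d r); first by rewrite lt_min d0 r0.
move=> s; rewrite lt_min => /andP[sd sr].
have fgu : f u = g u by have := fg 0; rewrite normr0 addr0; exact.
by rewrite -(fg s sr) -fgu dP.
Qed.

(** [flat 0] is the classical flat function. The index records the power of [x^-1] produced by
    differentiation: the derivative of [flat k] is a combination of [flat k.+1] and [flat k.+2], so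
    the family is closed under derivatives. *)
Definition flat (k : nat) (x : R) : R :=
  if 0 < x then x^-1 ^+ k * expR (- x^-1) else 0.

Lemma rderiv_flat k u : rderiv (flat k) u (- k%:R * flat k.+1 u + flat k.+2 u).
Proof.
have [u0|u0|<-] := ltgtP 0 u.
- pose g := fun x : R => x^-1 ^+ k * expR (- x^-1).
  apply: (@rderiv_near g _ _ _ u) => //.
    move=> s su; rewrite /flat /g; case: ifPn => // /negP []; move: su.
    by rewrite ltr_norml => /andP[? ?]; lra.
  apply: rderiv_is_derive.
  have un0 : u != 0 by rewrite gt_eqF.
  have dV : is_derive u 1 (fun x : R => x^-1) (- (u^-1 ^+ 2)).
    apply: is_derive_eq; first exact: is_deriveV.
    by rewrite /GRing.scale /= mulr1 exprVn.
  have dX : is_derive u 1 (fun x : R => x^-1 ^+ k)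
      ((k%:R * u^-1 ^+ k.-1) *: - (u^-1 ^+ 2)).
    rewrite (_ : (fun x => _) = (fun x : R => x^-1) ^+ k); first exact: is_deriveX.
    by apply/funext => x; rewrite exprfctE.
  have dN : is_derive u 1 (fun x : R => - x^-1) (u^-1 ^+ 2).
    by rewrite -[X in is_derive _ _ _ X]opprK; exact: is_deriveN.
  have dE : is_derive u 1 (fun x : R => expR (- x^-1))
      (u^-1 ^+ 2 * expR (- u^-1)) by rewrite mulrC;
    exact: (@is_derive1_comp _ expR (fun x : R => - x^-1)).
  rewrite (_ : _ + _ = u^-1 ^+ k *: (u^-1 ^+ 2 * expR (- u^-1)) +
      expR (- u^-1) *: ((k%:R * u^-1 ^+ k.-1) *: - (u^-1 ^+ 2))).
    exact: is_deriveM.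
  rewrite /flat u0 /GRing.scale /=; case: k {g dX} => [|k] /=.
    by rewrite !expr0 !expr2; ring.
  by rewrite !exprS; ring.
- apply: (@rderiv_near (fun=> 0) _ _ _ (- u)); first by rewrite oppr_gt0.
    by move=> s; rewrite ltr_norml => /andP[? ?]; rewrite /flat; case: ifPn => // ?; lra.
  rewrite /flat ltNge (ltW u0) /= mulr0 addr0 => e e0.
  by exists 1 => // s _; rewrite /= subr0 mul0r subr0 normr0 mulr_ge0// ltW.
- rewrite /flat ltxx mulr0 addr0 => e e0.
  (* The exponential series at [s^-1] gives [s^-1 ^+ k.+2 / C <= expR s^-1], hence for [s > 0] the
     difference quotient of [flat k] at [0] is at most [C * s]. *)
  pose C : R := (k.+2)`!%:R.
  have C0 : 0 < C by rewrite ltr0n fact_gt0.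
  exists (e / C); first by rewrite divr_gt0.
  move=> s sd; rewrite add0r mul0r subr0 ltxx subr0; case: ifPn => [s0|]; last first.
    by rewrite normr0 mulr_ge0// ltW.
  have v0 : 0 < s^-1 by rewrite invr_gt0.
  rewrite ger0_norm ?mulr_ge0 ?expR_ge0 ?exprn_ge0// ?(ltW v0)//.
  have H : (s^-1) ^+ k.+2 / C <= expR s^-1.
    have := expR_ge1Dxn k.+1 (ltW v0); rewrite -/C; lra.
  rewrite (ger0_norm (ltW s0)) in sd *.
  rewrite expRN ler_pdivrMr ?expR_gt0//.
  apply: le_trans (_ : e * s * (s^-1 ^+ k.+2 / C) <= _); last first.
    by rewrite ler_wpM2l// mulr_ge0// ltW.
  have -> : e * s * (s^-1 ^+ k.+2 / C) = s^-1 ^+ k * (e / C / s).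
    by rewrite !exprS; field; rewrite !gt_eqF.
  by rewrite ler_peMr ?exprn_ge0 ?(ltW v0)// ler_pdivlMr// mul1r ltW.
Qed.

Lemma flat_ge0 k x : 0 <= flat k x.
Proof.
rewrite /flat; case: ifPn => // x0.
by rewrite mulr_ge0 ?expR_ge0// exprn_ge0// invr_ge0 ltW.
Qed.

Lemma flat_gt0 k x : 0 < x -> 0 < flat k x.
Proof. by move=> x0; rewrite /flat x0 mulr_gt0 ?expR_gt0// exprn_gt0// invr_gt0. Qed.

Lemma flat_eq0 k x : x <= 0 -> flat k x = 0.
Proof. by rewrite /flat ltNge => ->. Qed.

Lemma rderivV u : u != 0 -> rderiv (fun x => x^-1) u (- (u^-1 * u^-1)).
Proof.
move=> u0; apply: rderiv_is_derive; apply: is_derive_eq; first exact: is_deriveV.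
by rewrite /GRing.scale /= mulr1 expr2 invfM.
Qed.

Definition step (x : R) : R := flat 0 x / (flat 0 x + flat 0 (1 - x)).

Lemma step_den_gt0 x : 0 < flat 0 x + flat 0 (1 - x).
Proof.
have [x0|x0] := ltP 0 x; first by rewrite ltr_wpDr ?flat_ge0 ?flat_gt0.
by rewrite ltr_wpDl ?flat_ge0 ?flat_gt0//; lra.
Qed.

Lemma step_ge0 x : 0 <= step x.
Proof. by rewrite divr_ge0 ?flat_ge0// ltW ?step_den_gt0. Qed.

Lemma step_le1 x : step x <= 1.
Proof. by rewrite ler_pdivrMr ?step_den_gt0// mul1r lerDl flat_ge0. Qed.

Lemma step_neq0 x : step x != 0 -> 0 < x.
Proof.
apply: contraNT; rewrite -leNgt => x0.
by rewrite /step flat_eq0// mul0r.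
Qed.

Lemma step_eq1 x : 1 <= x -> step x = 1.
Proof.
move=> x1; have d0 := step_den_gt0 x; move: d0.
rewrite /step [flat 0 (1 - x)]flat_eq0 ?addr0; last lra.
by move=> /lt0r_neq0 ?; rewrite divff.
Qed.

Lemma step_neq1 x : step x != 1 -> x < 1.
Proof. by apply: contraNT; rewrite -leNgt => /step_eq1 ->. Qed.

End RealFunctions.

(** * Functions depending locally on finitely many coordinates *)

(** Abstracts [C0] with [supnorm]. The bound [nf_eval] on evaluations is what makes expressions in
    finitely many coordinates differentiable. *)
Record normed_fspace (R : realType) (T : Type) (S : set (T -> R))
    (nrm : (T -> R) -> R) : Prop := NormedFspace {
  nf0 : S 0;
  nfD : forall x y, S x -> S y -> S (x + y);
  nfZ : forall a x, S x -> S (a *: x);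
  nf_nrmD : forall x y, S x -> S y -> nrm (x + y) <= nrm x + nrm y;
  nf_nrmZ : forall a x, S x -> nrm (a *: x) = `|a| * nrm x;
  nf_eval : forall x t, S x -> `|x t| <= nrm x }.

(** A syntax closed under partial differentiation, so that derivatives of every order are computed
    rather than shown to exist. Only [Inv] is partial; [valid] keeps track of its domain. *)
Inductive expr (R : Type) (T : Type) : Type :=
| Var of T
| Cst of R
| Add of expr R T & expr R T
| Mul of expr R T & expr R T
| Flat of nat & expr R T
| Inv of expr R T.
Arguments Var {R T}. Arguments Cst {R T}.

Section Expressions.
Variables (R : realType) (T : Type).
Local Notation E := (T -> R).
Local Notation expr := (expr R T).

Fixpoint eval (e : expr) (x : E) : R :=
  match e with
  | Var t => x t
  | Cst c => c
  | Add a b => eval a x + eval b x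
  | Mul a b => eval a x * eval b x
  | Flat k a => flat k (eval a x)
  | Inv a => (eval a x)^-1
  end.

Fixpoint valid (e : expr) (x : E) : Prop :=
  match e with
  | Var _ | Cst _ => True
  | Add a b | Mul a b => valid a x /\ valid b x
  | Flat _ a => valid a x
  | Inv a => valid a x /\ eval a x != 0
  end.

Definition gmul (c : expr) (G : seq (T * expr)) : seq (T * expr) :=
  [seq (g.1, Mul c g.2) | g <- G].

(* The gradient as a list of pairs (coordinate, partial derivative); a
   coordinate may occur several times, its contributions then add up. *)
Fixpoint grad (e : expr) : seq (T * expr) :=
  match e with
  | Var t => [:: (t, Cst 1)]
  | Cst _ => [::]
  | Add a b => grad a ++ grad b
  | Mul a b => gmul b (grad a) ++ gmul a (grad b)
  | Flat k a =>
      gmul (Add (Mul (Cst (- k%:R)) (Flat k.+1 a)) (Flat k.+2 a)) (grad a)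
  | Inv a => gmul (Mul (Cst (-1)) (Mul (Inv a) (Inv a))) (grad a)
  end.

Fixpoint all_prop {A : Type} (P : A -> Prop) (s : seq A) : Prop :=
  if s is a :: s' then P a /\ all_prop P s' else True.

Lemma all_prop_cat A (P : A -> Prop) s1 s2 :
  all_prop P s1 -> all_prop P s2 -> all_prop P (s1 ++ s2).
Proof. by elim: s1 => //= a s IH [Pa /IH H] /H. Qed.

Lemma all_prop_map A B (f : A -> B) (P : B -> Prop) s : all_prop (P \o f) s -> all_prop P (map f s).
Proof. by elim: s => //= a s IH [Pa /IH H]. Qed.

Lemma all_prop_imp A (P Q : A -> Prop) s : (forall a, P a -> Q a) -> all_prop P s -> all_prop Q s.
Proof. by move=> PQ; elim: s => //= a s IH [/PQ Qa /IH H]. Qed.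

Lemma valid_grad e x : valid e x -> all_prop (fun g => valid g.2 x) (grad e).
Proof.
have gmulP c G : valid c x -> all_prop (fun g => valid g.2 x) G ->
    all_prop (fun g => valid g.2 x) (gmul c G).
  by move=> vc vG; apply: all_prop_map; apply: all_prop_imp vG => g /=.
elim: e => //=.
- by move=> a IHa b IHb [va vb]; apply: all_prop_cat; auto.
- by move=> a IHa b IHb [va vb]; apply: all_prop_cat; apply: gmulP; auto.
- by move=> k a IHa va; apply: gmulP; auto.
- by move=> a IHa [va a0]; apply: gmulP; auto; split.
Qed.

Definition dlin (G : seq (T * expr)) (x h : E) : R :=
  \sum_(g <- G) h g.1 * eval g.2 x.

Lemma dlin_gmul c G x h : dlin (gmul c G) x h = eval c x * dlin G x h.
Proof. by rewrite /dlin big_map big_distrr /=; apply: eq_bigr => g _; ring. Qed.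

Lemma dlin_cat G1 G2 x h : dlin (G1 ++ G2) x h = dlin G1 x h + dlin G2 x h.
Proof. by rewrite /dlin big_cat. Qed.

Variables (S : set E) (nrm : E -> R).
Hypothesis SN : normed_fspace S nrm.

Lemma nrm_ge0 x : S x -> 0 <= nrm x.
Proof.
move=> Sx; have := nf_nrmD SN Sx (nfZ SN (-1) Sx).
by rewrite (nf_nrmZ SN) // scaleN1r subrr normrN normr1 mul1r
  -{1}(scale0r x) (nf_nrmZ SN) // normr0 mul0r; lra.
Qed.

Lemma nfB x y : S x -> S y -> S (x - y).
Proof. by move=> Sx Sy; rewrite -scaleN1r; apply: (nfD SN) => //; apply: (nfZ SN). Qed.

Lemma nrm0 : nrm 0 = 0.
Proof. by have := nf_nrmZ SN 0 (nf0 SN); rewrite scale0r normr0 mul0r. Qed.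

Lemma nrmBC x y : S x -> S y -> nrm (x - y) = nrm (y - x).
Proof.
move=> Sx Sy; rewrite -(opprB y x) -scaleN1r (nf_nrmZ SN) ?normrN ?normr1 ?mul1r//.
exact: nfB.
Qed.

Lemma nrm_dist3 z x y : S x -> S y -> S z -> nrm (x - y) <= nrm (x - z) + nrm (z - y).
Proof.
move=> Sx Sy Sz; have := nf_nrmD SN (nfB Sx Sz) (nfB Sz Sy).
by rewrite addrA subrK.
Qed.

Definition fdiff (F : E -> R) (x : E) (L : E -> R) : Prop :=
  forall e, 0 < e -> exists2 d, 0 < d & forall h, S h -> nrm h < d ->
    `|F (x + h) - F x - L h| <= e * nrm h.

Definition lbounded (L : E -> R) : Prop :=
  exists2 M, 0 <= M & forall h, S h -> `|L h| <= M * nrm h.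

Lemma dlin_bounded G x : lbounded (dlin G x).
Proof.
elim: G => [|g G [M M0 IH]].
  by exists 0 => // h Sh; rewrite /dlin big_nil normr0 mul0r.
exists (`|eval g.2 x| + M); first by rewrite addr_ge0.
move=> h Sh; rewrite /dlin big_cons (le_trans (ler_normD _ _))// mulrDl lerD//.
  by rewrite normrM mulrC ler_wpM2l// (nf_eval SN).
exact: IH.
Qed.

Lemma fdiff_lip F x L : lbounded L -> fdiff F x L ->
  exists2 M, 0 <= M & exists2 d, 0 < d & forall h, S h -> nrm h < d ->
    `|F (x + h) - F x| <= M * nrm h.
Proof.
move=> [M M0 LM] /(_ 1 ltr01)[d d0 dF]; exists (M + 1); first by rewrite addr_ge0.
exists d => // h Sh hd; have := dF h Sh hd; have := LM h Sh.
move: (F (x + h) - F x) (L h) => u v; rewrite mul1r mulrDl mul1r => h1 h2.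
by rewrite -[u](subrK v) (le_trans (ler_normD _ _))// addrC lerD.
Qed.

Lemma fdiffD F G x L K : fdiff F x L -> fdiff G x K ->
  fdiff (fun y => F y + G y) x (fun h => L h + K h).
Proof.
move=> dF dG e e0; have e2 : 0 < e / 2 by rewrite divr_gt0.
have [d1 d10 H1] := dF _ e2; have [d2 d20 H2] := dG _ e2.
exists (Num.min d1 d2); first by rewrite lt_min d10 d20.
move=> h Sh; rewrite lt_min => /andP[hd1 hd2].
have := H1 h Sh hd1; have := H2 h Sh hd2 => A B.
have -> : e * nrm h = e / 2 * nrm h + e / 2 * nrm h by field.
apply: le_trans (lerD A B); apply: le_trans (ler_normD _ _).
by rewrite le_eqVlt; apply/orP; left; apply/eqP; congr (`| _ |); ring.
Qed.

Lemma fdiffM F G x L K : lbounded L -> lbounded K -> fdiff F x L -> fdiff G x K ->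
  fdiff (fun y => F y * G y) x (fun h => G x * L h + F x * K h).
Proof.
move=> bL bK dF dG e e0.
have [M M0 LM] := bL.
have [N N0 [d0 d00 HN]] := fdiff_lip bK dG.
(* The remainder splits into four products, and [C] collects their coefficients. The two terms
   quadratic in [nrm h] are made linear by [nrm h < 1] and [nrm h < e / C]. *)
pose C := 1 + `|F x| + `|G x| + N + M * N.
have C0 : 0 < C by rewrite /C -!addrA ltr_pwDl// !addr_ge0// mulr_ge0.
have eC : 0 < e / C by rewrite divr_gt0.
have [d1 d10 H1] := dF _ eC; have [d2 d20 H2] := dG _ eC.
exists (Num.min (Num.min 1 (e / C)) (Num.min d0 (Num.min d1 d2))).
  by rewrite !lt_min ltr01 eC d00 d10 d20.
move=> h Sh; rewrite !lt_min => /and3P[/andP[h1 hC] hd0 /andP[hd1 hd2]].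
have := H1 h Sh hd1; have := H2 h Sh hd2; have := HN h Sh hd0; have := LM h Sh.
set f := F (x + h); set g := G (x + h); set n := nrm h in h1 hC hd0 hd1 hd2 *.
have n0 : 0 <= n by exact: nrm_ge0.
move=> A1 A2 A3 A4.
have -> : f * g - F x * G x - (G x * L h + F x * K h) =
  (f - F x - L h) * (g - G x) + (f - F x - L h) * G x + L h * (g - G x) +
  F x * (g - G x - K h) by ring.
apply: le_trans (_ : e / C * n * (N * n) + e / C * n * `|G x| + M * n * (N * n) +
   `|F x| * (e / C * n) <= _).
  apply: le_trans (ler_normD _ _) _; apply: lerD; last first.
    by rewrite normrM ler_wpM2l.
  apply: le_trans (ler_normD _ _) _; apply: lerD; last first.
    by rewrite normrM ler_pM.
  apply: le_trans (ler_normD _ _) _; apply: lerD; last first.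
    by rewrite normrM ler_wpM2r.
  by rewrite normrM ler_pM.
have -> : e * n = e / C * n * C by field; rewrite gt_eqF.
have en0 : 0 <= e / C * n by rewrite mulr_ge0// ltW.
have -> : e / C * n * C = e / C * n * N + e / C * n * `|G x| +
   M * N * (e / C * n) + `|F x| * (e / C * n) + e / C * n by rewrite /C; ring.
apply: le_trans (_ : _ <= e / C * n * N + e / C * n * `|G x| +
   M * N * (e / C * n) + `|F x| * (e / C * n)) _; last by rewrite lerDl.
rewrite lerD2r; apply: lerD; first rewrite lerD2r.
  by rewrite ler_wpM2l// ler_piMr// ltW.
have -> : M * n * (N * n) = M * N * (n * n) by ring.
by rewrite ler_wpM2l ?mulr_ge0// ler_wpM2r// ltW.
Qed.

Lemma fdiff_comp g a F x L : lbounded L -> rderiv g (F x) a -> fdiff F x L ->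
  fdiff (fun y => g (F y)) x (fun h => a * L h).
Proof.
move=> bL dg dF e e0.
have [N N0 [d0 d00 HN]] := fdiff_lip bL dF.
have e1 : 0 < e / 2 / (N + 1) by rewrite !divr_gt0// ltr_wpDl.
have e2 : 0 < e / 2 / (`|a| + 1) by rewrite !divr_gt0// ltr_wpDl.
have [d1 d10 H1] := dg _ e1; have [d2 d20 H2] := dF _ e2.
exists (Num.min (d1 / (N + 1)) (Num.min d0 d2)).
  by rewrite !lt_min d00 d20 divr_gt0// ltr_wpDl.
move=> h Sh; rewrite !lt_min => /and3P[hd1 hd0 hd2].
have n0 : 0 <= nrm h by exact: nrm_ge0.
have N1 : 0 < N + 1 by rewrite ltr_wpDl.
have B := HN h Sh hd0.
have Bd : `|F (x + h) - F x| < d1.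
  apply: le_lt_trans B _; rewrite ltr_pdivlMr// mulrC in hd1.
  by apply: le_lt_trans hd1; rewrite ler_wpM2r// lerDl.
have := H1 _ Bd; rewrite subrKC => A1; have := H2 h Sh hd2 => A2.
have -> : g (F (x + h)) - g (F x) - a * L h =
  (g (F (x + h)) - g (F x) - a * (F (x + h) - F x)) +
  a * (F (x + h) - F x - L h) by ring.
have -> : e * nrm h = e / 2 * nrm h + e / 2 * nrm h by field.
apply: le_trans (ler_normD _ _) _; apply: lerD.
  apply: le_trans A1 _; apply: le_trans (ler_wpM2l (ltW e1) B) _.
  rewrite mulrA ler_wpM2r// mulrAC ler_pdivrMr//.
  by rewrite ler_wpM2l ?lerDl// divr_ge0// ltW.
rewrite normrM; apply: le_trans (ler_wpM2l (normr_ge0 _) A2) _.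
rewrite mulrA ler_wpM2r// mulrA ler_pdivrMr ?ltr_wpDl// mulrC.
by rewrite ler_wpM2l ?lerDl// divr_ge0// ltW.
Qed.

Lemma fdiff_eval e x : S x -> valid e x -> fdiff (eval e) x (dlin (grad e) x).
Proof.
move=> Sx.
have ext F L L' : L =1 L' -> fdiff F x L -> fdiff F x L'.
  by move=> /funext ->.
have bd a := @dlin_bounded (grad a) x.
elim: e => /=.
- move=> t _ e e0; exists 1 => // h Sh _.
  rewrite /dlin big_seq1 /= mulr1 (_ : (x + h) t = x t + h t)//.
  by rewrite [x t + _]addrC addrK subrr normr0 mulr_ge0 ?nrm_ge0// ltW.
- move=> c _ e e0; exists 1 => // h Sh _.
  by rewrite /dlin big_nil subrr subr0 normr0 mulr_ge0 ?nrm_ge0// ltW.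
- move=> a IHa b IHb [va vb]; apply: ext (fdiffD (IHa va) (IHb vb)) => h.
  by rewrite dlin_cat.
- move=> a IHa b IHb [va vb]; apply: ext (fdiffM (bd a) (bd b) (IHa va) (IHb vb)) => h.
  by rewrite dlin_cat !dlin_gmul.
- move=> k a IHa va.
  apply: ext (fdiff_comp (bd a) (rderiv_flat k (eval a x)) (IHa va)) => h.
  by rewrite dlin_gmul.
- move=> a IHa [va a0].
  apply: ext (fdiff_comp (bd a) (rderivV a0) (IHa va)) => h.
  by rewrite dlin_gmul /= mulN1r.
Qed.

End Expressions.

(** * Iterated derivatives of expressions and smoothness *)

Section LocalExpressions.
Variables (R : realType) (T : Type).
Local Notation E := (T -> R).
Local Notation expr := (expr R T).

(** Partial derivatives of order [k], each with the word of coordinates of differentiation. Words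
    grow at the head because [smooth_on] puts the newest direction at the head of the argument
    list. *)
Fixpoint igrad (k : nat) (e : expr) : seq (seq T * expr) :=
  if k is k'.+1 then
    flatten [seq [seq (d.1 :: g.1, d.2) | d <- grad g.2] | g <- igrad k' e]
  else [:: ([::], e)].

Fixpoint wprod (hs : seq E) (w : seq T) : R :=
  match hs, w with
  | h :: hs', t :: w' => h t * wprod hs' w'
  | _, _ => 1
  end.

Definition iderive (e : expr) (k : nat) (x : E) (hs : seq E) : R :=
  \sum_(g <- igrad k e) wprod hs g.1 * eval g.2 x.

Lemma iderive_cons e k x h hs : iderive e k.+1 x (h :: hs) =
  \sum_(g <- igrad k e) wprod hs g.1 * dlin (grad g.2) x h.
Proof.
rewrite /iderive /= big_flatten big_map; apply: eq_bigr => g _.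
rewrite big_map /dlin big_distrr /=; apply: eq_bigr => d _; ring.
Qed.

Lemma igrad_size k e : all_prop (fun g => size g.1 = k) (igrad k e).
Proof.
elim: k => //= k IH; elim: (igrad k e) IH => //= g G IHG [gk /IHG H].
apply: all_prop_cat => //; apply: all_prop_map; elim: (grad g.2) => //= d s ?.
by split => //; rewrite gk.
Qed.

Lemma igrad_valid k e x : valid e x -> all_prop (fun g => valid g.2 x) (igrad k e).
Proof.
move=> ve; elim: k => //= k IH; elim: (igrad k e) IH => //= g G IHG [gk /IHG H].
by apply: all_prop_cat => //; apply: all_prop_map; exact: valid_grad.
Qed.

Lemma wprod_set_nth hs i (a : R) (u v : E) w : (i < size hs)%N -> size w = size hs ->
  wprod (set_nth 0 hs i (a *: u + v)) w =
  a * wprod (set_nth 0 hs i u) w + wprod (set_nth 0 hs i v) w.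
Proof.
elim: hs i w => [//|h hs IH] [|i] [|t w] //= ih [sw].
  rewrite (_ : (a *: u + v) t = a * u t + v t)//; ring.
by rewrite IH//; ring.
Qed.

Variables (S : set E) (nrm : E -> R).
Hypothesis SN : normed_fspace S nrm.

Lemma wprod_le_nrm hs w : (forall h, h \in hs -> S h) -> size w = size hs ->
  `|wprod hs w| <= \prod_(h <- hs) nrm h.
Proof.
elim: hs w => [|h hs IH] [|t w] //= Sh; first by rewrite big_nil normr1.
move=> [sw]; rewrite big_cons normrM ler_pM// ?(nf_eval SN)//.
  by apply: Sh; rewrite mem_head.
by apply: IH => // g gh; apply: Sh; rewrite inE gh orbT.
Qed.

(** Factors at least [1] make the bound valid for words of any length, since [wprod] stops at the
    shorter list; so one constant serves all words in [fdiff_usum]. *)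
Lemma wprod_le_max hs w : (forall h, h \in hs -> S h) ->
  `|wprod hs w| <= \prod_(h <- hs) Num.max 1 (nrm h).
Proof.
have P1 hs' : 1 <= \prod_(h <- hs') Num.max 1 (nrm h).
  elim: hs' => [|h hs' IH]; first by rewrite big_nil.
  by rewrite big_cons mulr_ege1// le_max lexx.
elim: hs w => [|h hs IH] [|t w] Sh; rewrite /= ?normr1 ?P1//.
rewrite big_cons normrM ler_pM// ?le_max ?(nf_eval SN) ?orbT//.
  by apply: Sh; rewrite mem_head.
by apply: IH => // g gh; apply: Sh; rewrite inE gh orbT.
Qed.

(* The estimate is uniform in the coefficients c, as required for
   differentiability in the operator norm. *)
Lemma fdiff_usum (G : seq (seq T * expr)) x (C : R) : S x -> 0 <= C ->
  all_prop (fun g => valid g.2 x) G ->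
  forall e, 0 < e -> exists2 d, 0 < d & forall h, S h -> nrm h < d ->
  forall c : seq T -> R, (forall w, `|c w| <= C) ->
  `|\sum_(g <- G) c g.1 * eval g.2 (x + h) - \sum_(g <- G) c g.1 * eval g.2 x -
    \sum_(g <- G) c g.1 * dlin (grad g.2) x h| <= e * nrm h.
Proof.
move=> Sx C0; elim: G => [_|g G IH [vg /IH{}IH]] e e0.
  exists 1 => // h Sh _ c _; rewrite !big_nil !subr0 normr0.
  by rewrite mulr_ge0 ?(nrm_ge0 SN)// ltW.
have e2 : 0 < e / 2 by rewrite divr_gt0.
have eC : 0 < e / 2 / (C + 1) by rewrite divr_gt0// ltr_wpDl.
have [d1 d10 H1] := IH _ e2; have [d2 d20 H2] := fdiff_eval SN Sx vg eC.
exists (Num.min d1 d2); first by rewrite lt_min d10 d20.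
move=> h Sh; rewrite lt_min => /andP[hd1 hd2] c cC.
have A := H1 h Sh hd1 c cC; have B := H2 h Sh hd2.
have -> : e * nrm h = e / 2 * nrm h + e / 2 * nrm h by field.
rewrite !big_cons.
set s1 := \sum_(j <- G) _ in A *; set s2 := \sum_(j <- G) _ in A *.
set s3 := \sum_(j <- G) _ in A *.
rewrite (_ : _ - _ - _ = c g.1 * (eval g.2 (x + h) - eval g.2 x - dlin (grad g.2) x h)
   + (s1 - s2 - s3)); last by ring.
apply: le_trans (ler_normD _ _) _; apply: lerD => //.
rewrite normrM; apply: le_trans (ler_wpM2l (normr_ge0 _) B) _.
rewrite mulrA ler_wpM2r ?(nrm_ge0 SN)// mulrA ler_pdivrMr ?ltr_wpDl// mulrC.
rewrite ler_wpM2l ?(le_trans (cC _))// ?lerDl// divr_ge0// ltW//.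
Qed.

Lemma fdiff_iderive e k x hs : S x -> valid e x -> (forall h, h \in hs -> S h) ->
  fdiff S nrm (fun y => iderive e k y hs) x (fun h => iderive e k.+1 x (h :: hs)).
Proof.
move=> Sx ve Shs; set C := \prod_(h <- hs) Num.max 1 (nrm h).
have wC w : `|wprod hs w| <= C by exact: wprod_le_max.
have C0 : 0 <= C by exact: le_trans (wC [::]).
move=> eps eps0; have [d d0 dP] := fdiff_usum Sx C0 (igrad_valid k ve) eps0.
by exists d => // h Sh hd; rewrite iderive_cons; exact: dP.
Qed.

(** Test both differentials at a small multiple [s *: h]. By homogeneity [s] cancels, and a nonzero
    difference [L h - L' h] would be smaller than itself. *)
Lemma fdiff_unique F F' x L L' r : 0 < r ->
  (forall h, S h -> nrm h < r -> F (x + h) = F' (x + h)) ->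
  (forall a h, L (a *: h) = a * L h) -> (forall a h, L' (a *: h) = a * L' h) ->
  fdiff S nrm F x L -> fdiff S nrm F' x L' -> forall h, S h -> L h = L' h.
Proof.
move=> r0 FF' LZ LZ' dF dF' h Sh; apply/eqP; rewrite -subr_eq0; apply: contraT.
rewrite -normr_gt0 => D0; set D := `|_| in D0.
have n0 := nrm_ge0 SN Sh.
have n1 : 0 < nrm h + 1 by rewrite ltr_wpDl.
(* Each of the two remainders is then at most [s * D / 4], half of what a contradiction allows; the
   [+ 1] covers [nrm h = 0]. *)
have e0 : 0 < D / 4 / (nrm h + 1) by rewrite !divr_gt0.
have [d1 d10 H1] := dF _ e0; have [d2 d20 H2] := dF' _ e0.
pose m := Num.min r (Num.min d1 d2).
have m0 : 0 < m by rewrite !lt_min r0 d10 d20.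
pose s := m / (nrm h + 1).
have s0 : 0 < s by rewrite divr_gt0.
have Ssh : S (s *: h) by exact: (nfZ SN).
have nsh : nrm (s *: h) = s * nrm h by rewrite (nf_nrmZ SN)// gtr0_norm.
have : nrm (s *: h) < m.
  by rewrite nsh /s mulrAC ltr_pdivrMr// ltr_pM2l// ltrDl.
rewrite !lt_min => /and3P[a1 a2 a3].
have := H1 _ Ssh a2; have := H2 _ Ssh a3.
have FF0 : F x = F' x by have := FF' 0 (nf0 SN); rewrite (nrm0 SN) addr0; exact.
rewrite FF'// FF0 LZ LZ' nsh.
move: (F' _ - F' x) => u A1 A2.
have : `|s * L h - s * L' h| <= D / 4 / (nrm h + 1) * (s * nrm h) *+ 2.
  rewrite (_ : _ - _ = (u - s * L' h) - (u - s * L h)); last by ring.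
  by rewrite (le_trans (ler_normB _ _))// mulr2n lerD.
rewrite -mulrBr normrM (gtr0_norm s0) -/D leNgt => /negP[].
rewrite (_ : _ *+ 2 = s * (D / 2 * (nrm h / (nrm h + 1)))); last first.
  by field; rewrite gt_eqF.
rewrite ltr_pM2l//; apply: le_lt_trans (_ : D / 2 * 1 < _); last lra.
by rewrite ler_wpM2l ?divr_ge0 ?(ltW D0)// ler_pdivrMr// mul1r lerDl.
Qed.

Lemma iderive_scale e k x a h hs :
  iderive e k.+1 x ((a *: h) :: hs) = a * iderive e k.+1 x (h :: hs).
Proof.
rewrite !iderive_cons big_distrr; apply: eq_bigr => g _ /=.
rewrite [RHS]mulrCA; congr (_ * _).
rewrite /dlin big_distrr; apply: eq_bigr => d _ /=.
by rewrite (_ : (a *: h) d.1 = a * h d.1)// mulrA.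
Qed.

(** Different expressions may represent the same function on a ball. Inductively, their derivatives
    of order [k.+1] are differentials of equal functions, and differentials are unique. *)
Lemma iderive_eq e e' x0 r :
  (forall y, S y -> nrm (y - x0) < r ->
    [/\ valid e y, valid e' y & eval e y = eval e' y]) -> S x0 ->
  forall k hs, (forall h, h \in hs -> S h) -> size hs = k ->
  forall y, S y -> nrm (y - x0) < r -> iderive e k y hs = iderive e' k y hs.
Proof.
move=> ee Sx0; elim=> [|k IH] [|h hs]//.
  by move=> _ _ y Sy yr; rewrite /iderive !big_seq1 /=; have [_ _ ->] := ee y Sy yr.
move=> Shs [shs] y Sy yr.
have Shs' h' : h' \in hs -> S h' by move=> h'h; apply: Shs; rewrite inE h'h orbT.
have [ve ve' _] := ee y Sy yr.
have dy : 0 < r - nrm (y - x0) by rewrite subr_gt0.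
apply: (fdiff_unique dy (L := fun h => iderive e k.+1 y (h :: hs))
  (L' := fun h => iderive e' k.+1 y (h :: hs)) _ _ _
  (fdiff_iderive _ Sy ve Shs') (fdiff_iderive _ Sy ve' Shs')).
- move=> g Sg gr; apply: IH => //; first exact: (nfD SN).
  rewrite addrAC [_ + g]addrC; apply: le_lt_trans (nf_nrmD SN Sg _) _; first exact: (nfB SN).
  by rewrite -ltrBrDr.
- by move=> a g; exact: iderive_scale.
- by move=> a g; exact: iderive_scale.
- by apply: Shs; rewrite mem_head.
Qed.

Definition lexpr (phi : E -> R) (x : E) : Prop :=
  exists2 r, 0 < r & exists e, forall y, S y -> nrm (y - x) < r ->
    valid e y /\ phi y = eval e y.

Lemma bounded_multilinear_iderive e k x : bounded_multilinear S nrm k (iderive e k x).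
Proof.
split.
  move=> hs i a u v shs ik _ _ _.
  rewrite /iderive big_distrr -big_split /=.
  elim: (igrad k e) (igrad_size k e) => [|g G IH /= [gk /IH{}IH]]; first by rewrite !big_nil.
  by rewrite !big_cons IH wprod_set_nth ?shs ?gk//; ring.
rewrite /iderive; elim: (igrad k e) (igrad_size k e) => [_|g G IH /= [gk /IH [M {}IH]]].
  by exists 0 => hs _ _; rewrite big_nil normr0 mul0r.
exists (`|eval g.2 x| + M) => hs shs Shs; rewrite big_cons.
rewrite (le_trans (ler_normD _ _))// mulrDl lerD ?IH// normrM mulrC ler_wpM2l//.
by apply: wprod_le_nrm => //; rewrite gk shs.
Qed.

(** The derivatives at [x] are read off an expression chosen for [x]. The expression chosen at
    [x + h] may be another one; [iderive_eq] allows replacing it by the one at [x]. *)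
Lemma lexpr_smooth phi : (forall x, S x -> lexpr phi x) -> smooth_on S nrm phi.
Proof.
move=> phiP.
have /choice[p pP] : forall x, exists p : R * expr, S x -> 0 < p.1 /\
    forall y, S y -> nrm (y - x) < p.1 -> valid p.2 y /\ phi y = eval p.2 y.
  move=> x; have [Sx|nSx] := pselect (S x); last by exists (0, Cst 0).
  by have [r r0 [e eP]] := phiP x Sx; exists (r, e).
have xx0 x : S x -> nrm (x - x) < (p x).1.
  by move=> Sx; rewrite subrr (nrm0 SN); have [] := pP x Sx.
exists (fun k x hs => iderive (p x).2 k x hs); split.
- move=> x Sx; rewrite /iderive big_seq1 /= mul1r.
  by have [_ /(_ x Sx (xx0 x Sx))[_ ->]] := pP x Sx.
- by move=> k x Sx; exact: bounded_multilinear_iderive.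
- move=> k x Sx eps eps0.
  have [p0 /[dup] pxP /(_ x Sx (xx0 x Sx))[vx _]] := pP x Sx.
  have [d d0 dP] := fdiff_usum Sx ler01 (igrad_valid k vx) eps0.
  exists (Num.min d (p x).1); first by rewrite lt_min d0 p0.
  move=> h Sh; rewrite lt_min => /andP[hd hp] hs shs Shs.
  have w1 w : `|wprod hs w| <= 1.
    elim: hs w {shs} Shs => [|g hs IH] [|t w] Shs; rewrite /= ?normr1//.
    have [Sg g1] := Shs g (mem_head _ _).
    rewrite normrM mulr_ile1// ?(le_trans (nf_eval SN _ Sg))// IH// => f fh.
    by apply: Shs; rewrite inE fh orbT.
  have Sxh : S (x + h) by exact: (nfD SN).
  have [q0 qP] := pP _ Sxh.
  have xhx : nrm (x + h - x) < (p x).1 by rewrite [x + h]addrC addrK.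
  (* The ball of this radius around [x + h] lies in the domains of both chosen expressions. *)
  pose r := Num.min (p (x + h)).1 ((p x).1 - nrm h).
  rewrite (@iderive_eq (p (x + h)).2 (p x).2 (x + h) r)//; last first.
  - by rewrite subrr (nrm0 SN) lt_min q0 subr_gt0.
  - by move=> g /Shs[].
  - move=> y Sy; rewrite lt_min => /andP[y1 y2].
    have [vy ey] := qP y Sy y1.
    have [|vy' ey'] := pxP y Sy _; last by split => //; rewrite -ey.
    apply: le_lt_trans (nrm_dist3 SN Sy Sx Sxh) _.
    by rewrite [x + h - x]addrAC subrr add0r -ltrBrDr.
  by rewrite iderive_cons; exact: dP.
Qed.

End LocalExpressions.

(** * Closure properties of locally elementary functions *)

Section LocalExpressionClosure.
Variables (R : realType) (T : Type).
Local Notation E := (T -> R).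
Variables (S : set E) (nrm : E -> R).
Hypothesis SN : normed_fspace S nrm.
Local Notation lexpr := (lexpr S nrm).

Definition around (x : E) (P : E -> Prop) : Prop :=
  exists2 r, 0 < r & forall y, S y -> nrm (y - x) < r -> P y.

Lemma aroundT x (P : E -> Prop) : (forall y, S y -> P y) -> around x P.
Proof. by move=> PT; exists 1 => // y Sy _; exact: PT. Qed.

Lemma aroundI x (P Q : E -> Prop) : around x P -> around x Q ->
  around x (fun y => P y /\ Q y).
Proof.
move=> [r r0 rP] [s s0 sQ]; exists (Num.min r s); first by rewrite lt_min r0 s0.
by move=> y Sy; rewrite lt_min => /andP[yr ys]; split; [exact: rP|exact: sQ].
Qed.

Lemma around_imp x (P Q : E -> Prop) : (forall y, S y -> P y -> Q y) ->
  around x P -> around x Q.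
Proof. by move=> PQ [r r0 rP]; exists r => // y Sy yr; apply: PQ (rP y Sy yr). Qed.

Lemma around_self x (P : E -> Prop) : S x -> around x P -> P x.
Proof. by move=> Sx [r r0]; apply=> //; rewrite subrr (nrm0 SN). Qed.

Lemma lexprP phi x : lexpr phi x <->
  exists e, around x (fun y => valid e y /\ phi y = eval e y).
Proof. by split=> [[r r0 [e eP]]|[e [r r0 eP]]]; [exists e, r|exists r => //; exists e]. Qed.

Lemma lexpr_ext phi psi x : around x (fun y => phi y = psi y) -> lexpr phi x -> lexpr psi x.
Proof.
move=> pp /lexprP[e eP]; apply/lexprP; exists e.
by apply: around_imp (aroundI pp eP) => y Sy [<-].
Qed.

Lemma lexpr_coord t x : lexpr (fun y => y t) x.
Proof. by apply/lexprP; exists (Var t); exact: aroundT. Qed.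

Lemma lexpr_cst c x : lexpr (fun=> c) x.
Proof. by apply/lexprP; exists (Cst c); exact: aroundT. Qed.

Lemma lexprD phi psi x : lexpr phi x -> lexpr psi x -> lexpr (fun y => phi y + psi y) x.
Proof.
move=> /lexprP[e eP] /lexprP[f fP]; apply/lexprP; exists (Add e f).
by apply: around_imp (aroundI eP fP) => y Sy [[? ->] [? ->]].
Qed.

Lemma lexprM phi psi x : lexpr phi x -> lexpr psi x -> lexpr (fun y => phi y * psi y) x.
Proof.
move=> /lexprP[e eP] /lexprP[f fP]; apply/lexprP; exists (Mul e f).
by apply: around_imp (aroundI eP fP) => y Sy [[? ->] [? ->]].
Qed.

Lemma lexprB phi psi x : lexpr phi x -> lexpr psi x -> lexpr (fun y => phi y - psi y) x.
Proof.
move=> p q; apply: lexpr_ext (lexprD p (lexprM (lexpr_cst (-1) x) q)).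
by apply: aroundT => y _; rewrite mulN1r.
Qed.

Lemma lexpr_flat k phi x : lexpr phi x -> lexpr (fun y => flat k (phi y)) x.
Proof.
move=> /lexprP[e eP]; apply/lexprP; exists (Flat k e).
by apply: around_imp eP => y Sy [? ->].
Qed.

Lemma lexpr_cont phi x : S x -> lexpr phi x ->
  forall e, 0 < e -> around x (fun y => `|phi y - phi x| < e).
Proof.
move=> Sx /lexprP[f fP] e e0.
have [vx fx] := around_self Sx fP.
have [M M0 [d d0 dM]] := fdiff_lip (dlin_bounded SN _ _) (fdiff_eval SN Sx vx).
have M1 : 0 < M + 1 by rewrite ltr_wpDl.
suff H : around x (fun y => `|eval f y - eval f x| < e).
  by apply: around_imp (aroundI fP H) => y Sy [[_ ->]]; rewrite fx.
exists (Num.min d (e / (M + 1))); first by rewrite lt_min d0 divr_gt0.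
move=> y Sy; rewrite lt_min ltr_pdivlMr// => /andP[yd ye].
have Syx := nfB SN Sy Sx.
have := dM _ Syx yd; rewrite subrKC => /le_lt_trans; apply.
apply: le_lt_trans ye; rewrite mulrC ler_wpM2l ?lerDl// (nrm_ge0 SN)//.
Qed.

Lemma lexpr_gt phi x c : S x -> lexpr phi x -> c < phi x -> around x (fun y => c < phi y).
Proof.
move=> Sx px cx; have e0 : 0 < phi x - c by rewrite subr_gt0.
apply: around_imp (lexpr_cont Sx px e0) => y _; rewrite ltr_norml => /andP[+ _]; lra.
Qed.

Lemma lexprV phi x : S x -> lexpr phi x -> 0 < phi x -> lexpr (fun y => (phi y)^-1) x.
Proof.
move=> Sx px x0; have p0 := lexpr_gt Sx px x0.
move: px => /lexprP[e eP]; apply/lexprP; exists (Inv e).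
by apply: around_imp (aroundI eP p0) => y Sy [[/= vy ->] /lt0r_neq0 ?].
Qed.

Lemma lexpr_step phi x : S x -> lexpr phi x -> lexpr (fun y => step (phi y)) x.
Proof.
move=> Sx px; rewrite /step; apply: lexprM; first exact: lexpr_flat.
apply: lexprV => //; last exact: step_den_gt0.
apply: lexprD; apply: lexpr_flat => //; apply: lexprB => //; exact: lexpr_cst.
Qed.

(** Precomposition with [y |-> a *: (y - z)] acts coordinatewise, so it can be carried out on the
    syntax. *)
Fixpoint subst_affine (a : R) (z : E) (e : expr R T) : expr R T :=
  match e with
  | Var t => Mul (Cst a) (Add (Var t) (Cst (- z t)))
  | Cst c => Cst c
  | Add e f => Add (subst_affine a z e) (subst_affine a z f)
  | Mul e f => Mul (subst_affine a z e) (subst_affine a z f)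
  | Flat k e => Flat k (subst_affine a z e)
  | Inv e => Inv (subst_affine a z e)
  end.

Lemma eval_subst_affine a z e y : eval (subst_affine a z e) y = eval e (a *: (y - z)).
Proof. by elim: e => //= [e -> f ->|e -> f ->|k e ->|e ->]. Qed.

Lemma valid_subst_affine a z e y :
  valid e (a *: (y - z)) -> valid (subst_affine a z e) y.
Proof.
elim: e => //=.
- by move=> e IHe f IHf [? ?]; split; auto.
- by move=> e IHe f IHf [? ?]; split; auto.
- by move=> e IHe [? ?]; rewrite eval_subst_affine; split; auto.
Qed.

Lemma lexpr_affine a z phi x : S x -> S z -> lexpr phi (a *: (x - z)) ->
  lexpr (fun y => phi (a *: (y - z))) x.
Proof.
move=> Sx Sz [r r0 [e eP]].
have a1 : 0 < `|a| + 1 by rewrite ltr_wpDl.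
exists (r / (`|a| + 1)); first by rewrite divr_gt0.
exists (subst_affine a z e) => y Sy yx; rewrite eval_subst_affine.
have [||v ->] := eP (a *: (y - z)).
- by apply: (nfZ SN); exact: (nfB SN).
- rewrite -scalerBr opprB addrA subrK (nf_nrmZ SN); last exact: (nfB SN).
  rewrite ltr_pdivlMr// mulrC in yx; apply: le_lt_trans yx.
  by rewrite ler_wpM2r ?lerDl// (nrm_ge0 SN)//; exact: (nfB SN).
- by split => //; exact: valid_subst_affine.
Qed.

(** [P i y] is to be read as: the index [i] is active at [y]. This covers nonzero summands as well
    as factors different from [1]. *)
Definition lfin (I : Type) (P : I -> E -> Prop) (x : E) : Prop :=
  exists2 A : set I, finite_set A & around x (fun y => forall i, P i y -> A i).

Lemma lfin_imp (I : Type) (P Q : I -> E -> Prop) x :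
  (forall i y, S y -> Q i y -> P i y) -> lfin P x -> lfin Q x.
Proof.
move=> QP [A fA AP]; exists A => //; apply: around_imp AP => y Sy H i /(QP _ _ Sy); exact: H.
Qed.

Lemma lfin_self (I : Type) (P : I -> E -> Prop) x : S x -> lfin P x ->
  finite_set [set i | P i x].
Proof.
move=> Sx [A fA /(around_self Sx) AP]; apply: sub_finite_set fA => i; exact: AP.
Qed.

(** Near [x] the support, which varies with [y], is contained in one fixed finite list of indices,
    over which induction applies. *)
Lemma lexpr_fsbig (idx : R) (op : Monoid.com_law idx) (I : choiceType)
    (g : I -> E -> R) x :
  (forall f f', lexpr f x -> lexpr f' x -> lexpr (fun y => op (f y) (f' y)) x) ->
  (forall i, lexpr (g i) x) -> lfin (fun i y => g i y != idx) x ->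
  lexpr (fun y => \big[op/idx]_(i \in [set: I]) g i y) x.
Proof.
move=> opP gP [A fA AP].
apply: (@lexpr_ext (fun y => \big[op/idx]_(i <- fset_set A) g i y)).
  apply: around_imp AP => y Sy H; rewrite -fsbigTE// => i iA.
  by apply: contra_notP (negP iA) => /eqP /H Ai; rewrite in_fset_set// inE.
elim: (fset_set A : seq I) => [|i s IH].
  by apply: lexpr_ext (lexpr_cst idx x); apply: aroundT => y; rewrite big_nil.
by apply: lexpr_ext (opP _ _ (gP i) IH); apply: aroundT => y; rewrite big_cons.
Qed.

Lemma lexpr_fsprod (I : choiceType) (g : I -> E -> R) x :
  (forall i, lexpr (g i) x) -> lfin (fun i y => g i y != 1) x ->
  lexpr (fun y => \big[*%R/1]_(i \in [set: I]) g i y) x.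
Proof. by apply: lexpr_fsbig => f f'; exact: lexprM. Qed.

Lemma lexpr_fssum (I : choiceType) (g : I -> E -> R) x :
  (forall i, lexpr (g i) x) -> lfin (fun i y => g i y != 0) x ->
  lexpr (fun y => \sum_(i \in [set: I]) g i y) x.
Proof. by apply: lexpr_fsbig => f f'; exact: lexprD. Qed.

Lemma lexpr_prod (I : Type) (s : seq I) (g : I -> E -> R) x :
  (forall i, lexpr (g i) x) -> lexpr (fun y => \prod_(i <- s) g i y) x.
Proof.
move=> gP; elim: s => [|i s IH].
  by apply: lexpr_ext (lexpr_cst 1 x); apply: aroundT => y; rewrite big_nil.
by apply: lexpr_ext (lexprM (gP i) IH); apply: aroundT => y; rewrite big_cons.
Qed.

End LocalExpressionClosure.

(** * From sigma-locally finite families to partitions of unity *)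

Section PartitionAssembly.
Variables (R : realType) (T : Type).
Local Notation E := (T -> R).
Variables (S : set E) (nrm : E -> R).
Hypothesis SN : normed_fspace S nrm.
Local Notation lexpr := (lexpr S nrm).
Local Notation lfin := (lfin S nrm).

Lemma lfin_lt (I : Type) (P : nat -> I -> E -> Prop) x N :
  (forall m, (m < N)%N -> lfin (P m) x) ->
  lfin (fun i y => exists2 m, (m < N)%N & P m i y) x.
Proof.
elim: N => [_|N IH PN]; first by exists set0 => //; apply: aroundT => y _ i [].
have [A fA AP] := PN N (ltnSn N).
have [|B fB BP] := IH; first by move=> m mN; apply: PN; rewrite ltnS ltnW.
exists (A `|` B); first by rewrite finite_setU.
apply: around_imp (aroundI AP BP) => y Sy [HA HB] i [m]; rewrite ltnS leq_eqVlt.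
by move=> /orP[/eqP-> /HA|mN Pm]; [left|right; apply: HB; exists m].
Qed.

Variables (J : choiceType) (n : J -> nat) (phi : J -> E -> R).
Hypothesis phiE : forall j x, S x -> lexpr (phi j) x.
Hypothesis phi0 : forall j x, S x -> 0 <= phi j x.
Hypothesis phif : forall m x, S x -> lfin (fun j y => n j = m /\ phi j y != 0) x.
Hypothesis phic : forall x, S x -> exists j, phi j x != 0.

(** The sum of the [m]-th locally finite layer. The layer condition sits in the summand so that the
    index set stays [setT], as in [lexpr_fssum]. *)
Let f m y := \sum_(j \in [set: J]) (if n j == m then phi j y else 0).

Let if_phiE m j x : S x -> lexpr (fun y => if n j == m then phi j y else 0) x.
Proof. by case: eqP => _ Sx; [exact: phiE|exact: lexpr_cst]. Qed.

Let fE m x : S x -> lexpr (f m) x.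
Proof.
move=> Sx; apply: lexpr_fssum => [j|]; first exact: if_phiE.
apply: lfin_imp (phif m Sx) => j y _ /=.
by case: (n j =P m) => [nj ?|_]; [split|rewrite /= eqxx].
Qed.

Let f_eq0 m x : (forall j, n j = m -> phi j x = 0) -> f m x = 0.
Proof. by move=> H; apply: fsbig1 => j _; case: eqP => // /H. Qed.

Lemma fssum_gt0 (I : choiceType) (g : I -> R) i : finite_set [set j | g j != 0] ->
  (forall j, 0 <= g j) -> g i != 0 -> 0 < \sum_(j \in [set: I]) g j.
Proof.
move=> fg g0 gi; rewrite lt_neqAle fsumr_ge0// andbT eq_sym.
apply/negP => /eqP; rewrite fsbig_supp => /pfsumr_eq0 H.
move/eqP: (gi); apply; apply: H => //; last by split => //; exact/eqP.
by rewrite setTI; apply: sub_finite_set fg => j /= /eqP.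
Qed.

Let f_gt0 j x : S x -> phi j x != 0 -> 0 < f (n j) x.
Proof.
move=> Sx pj; apply: (@fssum_gt0 _ _ j); last by rewrite eqxx.
- apply: sub_finite_set (lfin_self SN Sx (phif (n j) Sx)) => i /=.
  by case: (n i =P n j) => [ni ?|_]; [split|rewrite /= eqxx].
- by move=> i; case: ifP => // _; exact: phi0.
Qed.

(* The second factor vanishes near every point where some f k with k < n j is
   positive, as soon as n j is large: this makes the family chi locally finite. *)
Let chi j y := phi j y * \prod_(k <- iota 0 (n j)) flat 0 ((n j).+1%:R^-1 - f k y).

Let chiE j x : S x -> lexpr (chi j) x.
Proof.
move=> Sx; apply: lexprM; first exact: phiE.
apply: lexpr_prod => k; apply: lexpr_flat; apply: lexprB; last exact: fE.
exact: lexpr_cst.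
Qed.

Let chi_ge0 j x : S x -> 0 <= chi j x.
Proof.
move=> Sx; rewrite mulr_ge0 ?phi0// prodr_ge0// => k _; exact: flat_ge0.
Qed.

Let chi_phi j x : chi j x != 0 -> phi j x != 0.
Proof. by apply: contraNneq; rewrite /chi => ->; rewrite mul0r. Qed.

Let chif x : S x -> lfin (fun j y => chi j y != 0) x.
Proof.
move=> Sx; have [j0 j0x] := phic Sx.
have c0 := f_gt0 Sx j0x; set c := f _ _ in c0.
have c2 : c / 2 < c by lra.
have near := lexpr_gt SN Sx (fE (n j0) Sx) c2.
(* For layers [n j >= N] the product in [chi j] contains the factor of index [n j0], and
   [(n j).+1%:R^-1 < c / 2]; this factor vanishes wherever [f (n j0)] exceeds [c / 2]. *)
pose N := (n j0 + Num.truncn (c / 2)^-1)%N.+1.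
have Nc k : (N <= k)%N -> k.+1%:R^-1 < c / 2.
  move=> Nk; rewrite -[c / 2]invrK ltf_pV2 ?posrE ?invr_gt0 ?divr_gt0//.
  have /lt_le_trans := truncnS_gt (c / 2)^-1; apply.
  by rewrite ler_nat ltnS (leq_trans (leq_addl _ _) (ltnW Nk)).
have [A fA AP] := lfin_lt (N := N) (fun m _ => phif m Sx).
exists A => //; apply: around_imp (aroundI AP near) => y Sy [HA fy] j chij.
apply: HA; exists (n j); last by split => //; exact: chi_phi.
rewrite ltnNge; apply: contraNN chij => Nj.
rewrite /chi (@big_rem _ _ _ _ _ (n j0)) /=; last first.
  by rewrite mem_iota /= add0n (leq_trans _ Nj)// ltnS leq_addr.
rewrite flat_eq0 ?mul0r ?mulr0//.
by rewrite subr_le0 ltW// (lt_trans (Nc _ Nj)).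
Qed.

Let total y := \sum_(j \in [set: J]) chi j y.

(** In the least layer with a member nonzero at [x], nothing is damped: all earlier [f k] vanish at
    [x], so each factor is [flat 0] at a positive number. *)
Let total_gt0 x : S x -> 0 < total x.
Proof.
move=> Sx; have [j0 j0x] := phic Sx.
pose P m := `[< exists2 j, n j = m & phi j x != 0 >].
have exP : exists m, P m by exists (n j0); apply/asboolP; exists j0.
case: (ex_minnP exP) => m /asboolP[j nj jx] mmin.
apply: (@fssum_gt0 _ _ j).
- exact: (lfin_self SN Sx (chif Sx)).
- by move=> i; exact: chi_ge0.
- rewrite /chi mulf_neq0// prodf_seq_neq0; apply/allP => k; rewrite mem_iota add0n /= => kn.
  rewrite f_eq0 ?subr0 ?gt_eqF ?flat_gt0 ?invr_gt0//.
  move=> i ni; apply/eqP; apply: contraLR kn => ix; rewrite -leqNgt nj.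
  by apply: mmin; apply/asboolP; exists i.
Qed.

Lemma partition_assembly (UU : set (set E)) :
  (forall j, exists2 U, UU U & nclosure S nrm [set y | S y /\ phi j y != 0] `<=` U) ->
  exists psi : J -> E -> R, smooth_pou_subordinate S nrm UU psi.
Proof.
move=> phiU; exists (fun j y => chi j y * (total y)^-1).
have psi0 j y : chi j y * (total y)^-1 != 0 -> chi j y != 0.
  by rewrite mulf_eq0 negb_or => /andP[].
split.
- move=> j; apply: (lexpr_smooth SN) => x Sx; apply: lexprM; first exact: chiE.
  apply: (lexprV SN) => //; last exact: total_gt0.
  by apply: lexpr_fssum => [i|]; [exact: chiE|exact: chif].
- by move=> j x Sx; rewrite mulr_ge0 ?chi_ge0// invr_ge0 ltW// total_gt0.
- move=> x Sx; have [A fA [r r0 AP]] := chif Sx; exists r => //.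
  by apply: sub_finite_set fA => j /= [y [Sy yr] /psi0]; exact: AP.
- move=> x Sx; have t0 := total_gt0 Sx.
  rewrite (_ : [set j | _] = setT `&` (fun j => chi j x * (total x)^-1) @^-1` [set~ 0]).
    by rewrite -fsbig_supp -mulr_fsuml mulfV// gt_eqF.
  by apply/seteqP; split => j /=; [move=> /eqP ?; split|move=> [_ /eqP]].
- move=> j; have [U UUU jU] := phiU j; exists U => //.
  apply: subset_trans jU => x [Sx xcl]; split => // r /xcl[y [Sy /psi0 /chi_phi py] yr].
  by exists y.
Qed.

End PartitionAssembly.

(** * Trees and their topology *)

Section TreeOrder.
Variables (T : choiceType) (le : T -> T -> Prop).
Hypothesis tr : is_tree le.
Local Notation lt := (tlt le).

Lemma tle_refl t : le t t. Proof. by case: tr. Qed.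

Lemma tle_anti s t : le s t -> le t s -> s = t. Proof. by case: tr => _ + _ _ _; apply. Qed.

Lemma tle_trans s r t : le r s -> le s t -> le r t.
Proof. by case: tr => _ _ + _ _; apply. Qed.

Lemma tlt_le_trans s r t : lt r s -> le s t -> lt r t.
Proof.
move=> [rs nrs] st; split; first exact: tle_trans st.
by move=> rt; apply: nrs; apply: tle_anti => //; rewrite rt.
Qed.

Lemma tle_lt_trans s r t : le r s -> lt s t -> lt r t.
Proof.
move=> rs [st nst]; split; first exact: tle_trans st.
by move=> rt; apply: nst; apply: tle_anti => //; rewrite -rt.
Qed.

Lemma tlt_nle s t : lt s t -> ~ le t s.
Proof. by move=> [st nst] /(tle_anti st). Qed.

Lemma tree_min t (P : T -> Prop) : (exists2 s, le s t & P s) ->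
  exists2 m, le m t /\ P m & forall s, le s t -> P s -> le m s.
Proof.
move=> [s st Ps]; have [_ _ _ wo _] := tr.
have [||m [mt Pm] mmin] := wo t [set s | le s t /\ P s]; first by move=> ? [].
  by exists s.
by exists m => // r rt Pr; apply: mmin.
Qed.

Lemma tle_total t s r : le s t -> le r t -> le s r \/ le r s.
Proof.
move=> st rt; have [|m [_ [->|->]] mmin] := @tree_min t (fun x => x = s \/ x = r).
- by exists s => //; left.
- by left; apply: mmin => //; right.
- by right; apply: mmin => //; left.
Qed.

Lemma tnle_lt t s r : le s t -> le r t -> ~ le s r -> lt r s.
Proof.
move=> st rt nsr; have [//|rs] := tle_total st rt.
by split => // rs'; apply: nsr; rewrite rs'; exact: tle_refl.
Qed.

Lemma tle_eqVlt s t : le s t -> s = t \/ lt s t.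
Proof. by move=> st; have [->|nst] := pselect (s = t); [left|right]. Qed.

Lemma tlt_ind (P : T -> Prop) : (forall t, (forall s, lt s t -> P s) -> P t) -> forall t, P t.
Proof.
move=> IH t; apply: contrapT => nPt.
have [|m [mt nPm] mmin] := @tree_min t (fun x => ~ P x); first by exists t => //; exact: tle_refl.
apply: nPm; apply: IH => s sm; apply: contrapT => nPs.
by apply: (tlt_nle sm); apply: mmin => //; apply: tle_trans mt; case: sm.
Qed.

Definition tsucc (t s : T) : Prop := lt t s /\ forall w, lt w s -> le w t.

Lemma tsucc_below t u : lt t u -> exists2 s, tsucc t s & le s u.
Proof.
move=> tu; have [|s [su nst] smin] := @tree_min u (fun x => ~ le x t).
  by exists u; [exact: tle_refl|exact: tlt_nle].
exists s => //; split; first by apply: (tnle_lt su) => //; case: tu.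
move=> w ws; apply: contrapT => nwt; apply: (tlt_nle ws).
by apply: smin => //; apply: tle_trans su; case: ws.
Qed.

Lemma tsucc_inj t s r y : tsucc t s -> tsucc t r -> le s y -> le r y -> s = r.
Proof.
have H s' r' : tsucc t s' -> tsucc t r' -> le s' r' -> s' = r'.
  move=> [ts _] [_ rt] sr; have [//|/rt st] := tle_eqVlt sr.
  by case: (tlt_nle ts).
move=> ss sr sy ry; have [sr'|rs] := tle_total sy ry; first exact: H.
by apply/esym/H.
Qed.

Lemma tree_pos t : (forall s, ~ lt s t) \/ (exists p, tsucc p t) \/ tree_limit le t.
Proof.
have [[s st]|nex] := pselect (exists s, lt s t); last first.
  by left=> s st; apply: nex; exists s.
right; have [[m [mt mmax]]|nm] := pselect (exists m, lt m t /\ forall s, lt s t -> le s m).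
  by left; exists m.
by right; split => //; exists s.
Qed.

(* A neighbourhood of y contains a set of this form, see nbhs_tbelow. *)
Definition tbelow (y : T) (P : T -> Prop) : Prop :=
  (exists2 v, lt v y & forall w, le w y -> ~ le w v -> P w) \/ forall w, le w y -> P w.

Lemma tbelowI y P Q : tbelow y P -> tbelow y Q -> tbelow y (fun w => P w /\ Q w).
Proof.
move=> [[v vy Pv]|yP] [[v' vy' Qv]|yQ].
- have [vv|vv] := tle_total (proj1 vy) (proj1 vy').
    left; exists v' => // w wy wv; split; [apply: Pv|apply: Qv] => // w'.
    by apply: wv; exact: tle_trans vv.
  left; exists v => // w wy wv; split; [apply: Pv|apply: Qv] => // w'.
  by apply: wv; exact: tle_trans vv.
- by left; exists v => // w wy wv; split; [exact: Pv|exact: yQ].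
- by left; exists v' => // w wy wv; split; [exact: yP|exact: Qv].
- by right => w wy; split; [exact: yP|exact: yQ].
Qed.

Lemma tbelow_imp y (P Q : T -> Prop) : (forall w, le w y -> P w -> Q w) -> tbelow y P -> tbelow y Q.
Proof.
move=> PQ [[v vy Pv]|yP]; last by right => w wy; apply: PQ => //; exact: yP.
by left; exists v => // w wy wv; apply: PQ => //; exact: Pv.
Qed.

(* The only place where the Hausdorff condition enters. *)
Lemma tbelow_nle y t : ~ le y t -> tbelow y (fun w => ~ le w t).
Proof.
move=> nyt; have [|m [my nmt] mmin] := @tree_min y (fun x => ~ le x t).
  by exists y => //; exact: tle_refl.
have mt w : le w y -> le m w -> ~ le w t by move=> _ mw wt; apply: nmt; exact: tle_trans wt.
have mle w : lt w m -> le w t.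
  move=> wm; apply: contrapT => nwt; apply: (tlt_nle wm); apply: mmin => //.
  by apply: tle_trans my; case: wm.
have [mm|[[p pm]|lm]] := tree_pos m.
- right => w wy; apply: mt => //; apply: contrapT => nmw.
  by apply: (mm w); exact: (tnle_lt my wy nmw).
- left; exists p; first exact: tlt_le_trans (proj1 pm) my.
  move=> w wy nwp; apply: mt => //; apply: contrapT => nmw; apply: nwp.
  by apply: (proj2 pm); exact: (tnle_lt my wy nmw).
(* Everything strictly below [m] lies below [t]. Either [(0, t]] lies within [(0, m)], and [t] is
   its greatest element, or the least element [m'] of [(0, t]] outside [(0, m)] has the same
   predecessors as [m], and the Hausdorff condition yields [m = m']. *)
- exfalso; have [[w [wt nwm]]|nB] := pselect (exists w, le w t /\ ~ lt w m); last first.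
    case: lm => _ []; exists t; split; last by move=> s; exact: mle.
    by apply: contrapT => ntm; apply: nB; exists t; split => //; exact: tle_refl.
  have [|m' [m't nm'm] m'min] := @tree_min t (fun x => ~ lt x m); first by exists w.
  suff mm' : m = m' by apply: nmt; rewrite mm'.
  have [_ _ _ _ hd] := tr; apply: hd => // s; split=> [sm|sm'].
    have st := mle _ sm; apply: (tnle_lt m't st) => m's.
    by apply: nm'm; exact: tle_lt_trans sm.
  apply: contrapT => nsm; apply: (tlt_nle sm'); apply: m'min => //.
  by apply: tle_trans m't; case: sm'.
Qed.

Lemma tree_subbase_open i : open (@tree_subbase T le i).
Proof.
exists [set tree_subbase i]; last by rewrite bigcup_set1.
by move=> A ->; exact: finI_from1.
Qed.

Lemma open_tle t : open ([set s | le s t] : set (tree_top le)).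
Proof. exact: (tree_subbase_open (Some (true, t))). Qed.

Lemma closed_tle t : closed ([set s | le s t] : set (tree_top le)).
Proof. by rewrite -openC; exact: (tree_subbase_open (Some (false, t))). Qed.

Lemma nbhs_tbelow (y : tree_top le) (U : set (tree_top le)) : nbhs y U -> tbelow y U.
Proof.
case=> B [[D sD <-] [i /= /[dup] Di /sD [F _ Fi] yi] BU].
have yF : (\bigcap_(j in [set` F]) tree_subbase (le := le) j) y by rewrite Fi.
apply: (@tbelow_imp _ (\bigcap_(j in [set` F]) tree_subbase j)).
  move=> w _ wF; apply: BU; exists i => //. by rewrite -Fi; exact: wF.
pose H := forall s : seq (option (bool * T)), (forall j, j \in s -> tree_subbase (le := le) j y) ->
  tbelow y (fun w => forall j, j \in s -> tree_subbase (le := le) j w).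
suff : H by move=> /(_ F) Hs; apply: Hs => j jF; exact: yF.
elim=> [|j s IH] sy; first by right.
have : tbelow y (fun w => tree_subbase (le := le) j w /\
    forall k, k \in s -> tree_subbase (le := le) k w).
  apply: tbelowI; last by apply: IH => k ks; apply: sy; rewrite inE ks orbT.
  have := sy j (mem_head _ _); case: j {sy} => [[[] t]|] /=; last by right.
    by move=> yt; right => w wy; exact: tle_trans yt.
  exact: tbelow_nle.
apply: tbelow_imp => w _ [wj ws] k; rewrite inE => /orP[/eqP ->//|]; exact: ws.
Qed.

(** The cluster point of a filter [F] is the least [y] such that every member of [F] meets [(0, y]].
    For [v] strictly below [y], some member of [F] misses [(0, v]], so all members meet [(v, y]]. *)
Lemma compact_tle t : compact ([set s | le s t] : set (tree_top le)).
Proof.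
move=> F FF Ft.
have [|y [yt yF] ymin] := @tree_min t (fun y => forall A, F A -> exists2 s, A s & le s y).
  exists t; first exact: tle_refl.
  move=> A FA; have : F (A `&` [set s | le s t]) by exact: filterI.
  by move=> /filter_ex[s [As st]]; exists s.
exists y; split => //= A U FA /nbhs_tbelow [[v vy Uv]|Uy]; last first.
  by have [s As sy] := yF A FA; exists s; split => //; exact: Uy.
have [B FB Bv] : exists2 B, F B & forall s, B s -> ~ le s v.
  apply: contrapT => nB; apply: (tlt_nle vy); apply: ymin; first by apply: tle_trans yt; case: vy.
  move=> A' FA'; apply: contrapT => nA'; apply: nB; exists A' => // s A's sv.
  by apply: nA'; exists s.
have [s [As Bs] sy] := yF _ (filterI FA FB).
by exists s; split => //; apply: Uv => //; exact: Bv.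
Qed.

End TreeOrder.

(** * The space C_0 of a tree *)

(* The cover characterization of compactness in the library requires a pointed
   space. *)
Lemma compact_seq_cover (X : topologicalType) (A : set X) (I : eqType) (U : I -> set X) :
  compact A -> (forall i, open (U i)) -> (forall x, A x -> exists i, U i x) ->
  exists s : seq I, forall x, A x -> exists2 i, i \in s & U i x.
Proof.
move=> cA oU AU; apply: contrapT => ns.
pose B (s : seq I) : set X := [set x | A x /\ forall i, i \in s -> ~ U i x].
have FB : Filter (filter_from setT B).
  apply: filter_from_filter; first by exists [::].
  move=> s1 s2 _ _; exists (s1 ++ s2) => // x [Ax xs].
  by split; split => // i is_; apply: xs; rewrite mem_cat is_ ?orbT.
have PB : ProperFilter (filter_from setT B).
  apply: filter_from_proper => s _; apply: contrapT => nB; apply: ns; exists s => x Ax.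
  apply: contrapT => nx; apply: nB; exists x; split => // i is_ Ui; apply: nx.
  by exists i.
have [|x [Ax xB]] := cA _ PB; first by exists [::] => // x [].
have [i Ui] := AU x Ax.
have [|y [[_ /(_ i (mem_head _ _)) nUi] Uy]] := xB (B [:: i]) (U i) _ (open_nbhs_nbhs (conj (oU i) Ui)).
  by exists [:: i].
exact: nUi.
Qed.

Lemma continuous_normf (R : realType) (X : topologicalType) (f : X -> R) :
  continuous f -> continuous (fun t => `|f t|).
Proof. by move=> cf t; apply: cvg_norm; exact: cf. Qed.

Section TreeC0.
Variables (R : realType) (T : choiceType) (le : T -> T -> Prop).
Hypothesis tr : is_tree le.
Local Notation lt := (tlt le).
Local Notation E := (tree_top le -> R).
Local Notation S := (@C0 R T le).
Local Notation nrm := (@supnorm R T le).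
Local Notation tle_refl := (tle_refl tr).
Local Notation tsucc := (tsucc le).

Lemma C0_cover (f : E) (rho : R) : S f -> 0 < rho ->
  exists s : seq T, forall t, rho <= `|f t| -> exists2 u, u \in s & le t u.
Proof.
move=> [_ fK] /fK /(@compact_seq_cover (tree_top le) _ T (fun t => [set s | le s t])); apply.
  exact: open_tle.
by move=> t _; exists t; exact: tle_refl.
Qed.

Lemma C0_tbelow (f : E) y e : S f -> 0 < e -> tbelow le y (fun w => `|f w - f y| < e).
Proof.
move=> [cf _] e0; apply: (nbhs_tbelow tr).
have /cvgrPdist_lt /(_ e e0) := cf y.
by apply: filterS => w; rewrite distrC.
Qed.

(** Either [|f|] stays below [rho] or it attains its maximum. Knowing that [M] is [rho] or a value
    of [|f|] turns a strict pointwise bound into a strict uniform one. *)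
Lemma C0_max (f : E) (rho : R) : S f -> 0 < rho -> exists2 M, forall t, `|f t| <= M &
  M = rho \/ exists c, M = `|f c|.
Proof.
move=> [cf fK] rho0.
have [[t0 t0P]|nt] := pselect (exists t, rho <= `|f t|); last first.
  exists rho; last by left.
  by move=> t; rewrite leNgt; apply/negP => /ltW ft; apply: nt; exists t.
have [||c _ cP] := @compact_EVT_max _ _ (fun t => `|f t|) _ _ (fK _ rho0).
- by exists t0.
- by apply: continuous_subspaceT; exact: continuous_normf.
exists `|f c|; last by right; exists c.
have ct0 : `|f t0| <= `|f c| by apply: cP; rewrite inE.
move=> t; have [ft|/ltW ft] := leP rho `|f t|; first by apply: cP; rewrite inE.
by rewrite (le_trans ft)// (le_trans t0P).
Qed.

Lemma supnorm_eval (f : E) t : S f -> `|f t| <= nrm f.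
Proof.
move=> Sf; apply: ub_le_sup; last by exists t.
by have [M fM _] := C0_max Sf ltr01; exists M => _ [s _ <-].
Qed.

(** The tree may be empty; [supnorm] is then the supremum of the empty set, [0] by convention. *)
Lemma supnorm_void (f : E) : (T -> False) -> nrm f = 0.
Proof.
by move=> nt; rewrite -[RHS](@sup0 R); congr sup; rewrite -subset0 => x [t]; case: (nt t).
Qed.

Lemma supnorm_le (f : E) M : 0 <= M -> (forall t, `|f t| <= M) -> nrm f <= M.
Proof.
move=> M0 fM; have [[t0 _]|nt] := pselect (exists t : T, True).
  by apply: ge_sup; [exists `|f t0|, t0|move=> _ [t _ <-]].
by rewrite supnorm_void// => t; apply: nt; exists t.
Qed.

Lemma C0_sub (f : E) (P : R -> set (tree_top le)) : continuous f ->
  (forall e, 0 < e -> compact (P e) /\ [set t | e <= `|f t|] `<=` P e) -> S f.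
Proof.
move=> cf fP; split => // e /fP[cP fe]; apply: subclosed_compact cP fe.
rewrite (_ : [set t | _] = (fun t => `|f t|) @^-1` [set x | e <= x])//.
apply: closed_comp => [t _|]; last exact: closed_ge.
exact: (continuous_normf cf).
Qed.

Lemma C0_normed_fspace : normed_fspace S nrm.
Proof.
have C00 : S 0.
  apply: (@C0_sub _ (fun=> set0)); first exact: cst_continuous.
  move=> e e0; split; first exact: compact0.
  by move=> t /=; rewrite normr0 leNgt e0.
have C0D (x y : E) : S x -> S y -> S (x + y).
  move=> [cx xK] [cy yK].
  apply: (@C0_sub _ (fun e => [set t | e / 2 <= `|x t|] `|` [set t | e / 2 <= `|y t|])).
    by move=> t; apply: continuousD; [exact: cx|exact: cy].
  move=> e e0; have e2 : 0 < e / 2 by rewrite divr_gt0.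
  split; first by apply: compactU; [exact: xK|exact: yK].
  move=> t /= et; have [|xt] := leP (e / 2) `|x t|; first by left.
  right; rewrite leNgt; apply/negP => yt; move: et; rewrite leNgt => /negP[].
  by rewrite (splitr e) (le_lt_trans (ler_normD _ _))// ltrD.
have C0Z a (x : E) : S x -> S (a *: x).
  have [-> _|a0] := eqVneq a 0; first by rewrite scale0r.
  move=> [cx xK]; apply: (@C0_sub _ (fun e => [set t | e / `|a| <= `|x t|])).
    by move=> t; apply: continuousM; [exact: cst_continuous|exact: cx].
  move=> e e0; split; first by apply: xK; rewrite divr_gt0// normr_gt0.
  move=> t /=; rewrite ler_pdivrMr ?normr_gt0// mulrC -normrM; exact.
have n0 (x : E) : S x -> 0 <= nrm x.
  move=> Sx; have [[t0 _]|nt] := pselect (exists t : T, True).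
    exact: le_trans (supnorm_eval t0 Sx).
  by rewrite supnorm_void// => t; apply: nt; exists t.
have nZ a (x : E) : S x -> nrm (a *: x) <= `|a| * nrm x.
  move=> Sx; apply: supnorm_le => [|t]; first by rewrite mulr_ge0// n0.
  by rewrite (_ : (a *: x) t = a * x t)// normrM ler_wpM2l// supnorm_eval.
split => //.
- move=> x y Sx Sy; apply: supnorm_le => [|t]; first by rewrite addr_ge0// n0.
  by rewrite (le_trans (ler_normD _ _))// lerD// supnorm_eval.
- move=> a x Sx; apply/eqP; rewrite eq_le nZ//=.
  have [->|a0] := eqVneq a 0; first by rewrite normr0 mul0r n0//; exact: C0Z.
  have := nZ a^-1 _ (C0Z a _ Sx); rewrite scalerA mulVf// scale1r normfV.
  by rewrite ler_pdivlMl ?normr_gt0.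
- by move=> x t; exact: supnorm_eval.
Qed.

(** Well-founded induction on [y]. By continuity [f] varies by less than [rho] on some [(v, y]], so
    besides the jumps below [v] only the one starting at [v] towards [y] can be large. *)
Lemma finite_jumps_below (f : E) (rho : R) y : S f -> 0 < rho ->
  finite_set [set p : T * T | [/\ tsucc p.1 p.2, le p.2 y & rho <= `|f p.2 - f p.1|]].
Proof.
move=> Sf rho0; have r2 : 0 < rho / 2 by rewrite divr_gt0.
elim/(tlt_ind tr): y => y IH.
have near2 s t : `|f s - f y| < rho / 2 -> `|f t - f y| < rho / 2 -> ~ (rho <= `|f s - f t|).
  move=> sy ty; apply/negP; rewrite -ltNge -(subrK (f y) (f s)) -addrA.
  by rewrite (splitr rho) (le_lt_trans (ler_normD _ _))// ltrD// distrC.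
have [[v vy vP]|yP] := C0_tbelow y Sf r2; last first.
  apply: (@sub_finite_set _ _ set0) => // -[t s] /= [ts sy].
  by apply: near2; apply: yP => //; apply: (tle_trans tr _ sy); case: ts => -[].
apply: (@sub_finite_set _ _ ([set p : T * T | [/\ tsucc p.1 p.2, le p.2 v & rho <= `|f p.2 - f p.1|]]
  `|` [set p | p.1 = v /\ (tsucc v p.2 /\ le p.2 y)])).
  move=> [t s] /= [ts sy fts]; have [sv|nsv] := pselect (le s v); [by left|right].
  have ty : le t y by apply: (tle_trans tr _ sy); case: ts => -[].
  have tv : le t v.
    apply: contrapT => ntv; apply: near2 fts; exact: vP.
  have vs : lt v s := tnle_lt tr sy (proj1 vy) nsv.
  have vt : le v t by apply: (proj2 ts).
  by have tv' := tle_anti tr tv vt; rewrite -tv'.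
rewrite finite_setU; split; first exact: IH.
have [[s0 [s0v s0y]]|ns] := pselect (exists s, tsucc v s /\ le s y); last first.
  by apply: (@sub_finite_set _ _ set0) => // -[t s] /= [_ ?]; apply: ns; exists s.
apply: (@sub_finite_set _ _ [set (v, s0)]) => //.
by move=> [t s] /= [-> [sv sy]]; congr (_, _); exact: (tsucc_inj tr sv s0v sy s0y).
Qed.

Lemma finite_bigcup_seq (I J : choiceType) (s : seq I) (A : I -> set J) :
  (forall i, finite_set (A i)) -> finite_set (\bigcup_(i in [set` s]) A i).
Proof. by move=> fA; apply: bigcup_finite => //; exact: finite_seq. Qed.

Lemma finite_jumps (f : E) (rho : R) : S f -> 0 < rho ->
  finite_set [set p : T * T | [/\ tsucc p.1 p.2, rho <= `|f p.2| & rho <= `|f p.2 - f p.1|]].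
Proof.
move=> Sf rho0; have [s sP] := C0_cover Sf rho0.
apply: sub_finite_set (finite_bigcup_seq s (fun u => finite_jumps_below u Sf rho0)).
by move=> [t r] /= [tr' /sP[u us ru] ftr]; exists u.
Qed.

(** Cover [{|f| >= rho}] by finitely many [(0, u]]. A point [t] in question is some [u] itself, or
    else its successor towards [u] is one of the finitely many large jumps below [u]. *)
Lemma finite_ends (f : E) (rho : R) : S f -> 0 < rho ->
  finite_set [set t | rho <= `|f t| /\ forall s, tsucc t s -> rho <= `|f s - f t|].
Proof.
move=> Sf rho0; have [s sP] := C0_cover Sf rho0.
apply: (@sub_finite_set _ _ ([set` s] `|` \bigcup_(u in [set` s]) (fst @`
  [set p : T * T | [/\ tsucc p.1 p.2, le p.2 u & rho <= `|f p.2 - f p.1|]]))); last first.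
  rewrite finite_setU; split; first exact: finite_seq.
  by apply: finite_bigcup_seq => u; apply: finite_image; exact: finite_jumps_below.
move=> t [/sP[u us tu] tP]; have [->|tu'] := tle_eqVlt tu; [by left|right].
have [r tr' ru] := tsucc_below tr tu'.
by exists u => //=; exists (t, r) => //; split => //; exact: tP.
Qed.

Lemma finite_tsucc_big (f : E) (rho : R) t : S f -> 0 < rho ->
  finite_set [set s | tsucc t s /\ rho <= `|f s|].
Proof.
move=> Sf rho0; have [s sP] := C0_cover Sf rho0.
apply: sub_finite_set (finite_bigcup_seq s (A := fun u => [set r | tsucc t r /\ le r u]) _).
  by move=> r [tr' /sP[u us ru]]; exists u.
move=> u; have [[s0 [s0t s0u]]|ns] := pselect (exists r, tsucc t r /\ le r u); last first.
  by apply: (@sub_finite_set _ _ set0) => // r ?; apply: ns; exists r.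
apply: (@sub_finite_set _ _ [set s0]) => //.
by move=> r /= [rt ru]; exact: (tsucc_inj tr rt s0t ru s0u).
Qed.

(** Let [m] be the first point above [x], on the way to [t], where [f] differs from [a]. By
    continuity [f] differs from [a] on some [(v, m]], which forces [m] to be the immediate successor
    of [v]: the level ends at [v]. *)
Lemma level_end_below (f : E) x a t : S f -> f x = a -> le x t ->
  exists2 u, [/\ le x u, le u t & forall w, le x w -> le w u -> f w = a] &
    forall v, le x v -> le v t -> (forall w, le x w -> le w v -> f w = a) -> le v u.
Proof.
move=> Sf fx xt.
have [[w0 [w0t xw0 fw0]]|nB] := pselect (exists w, [/\ le w t, le x w & f w <> a]); last first.
  exists t; last by [].
  split => //; first exact: tle_refl.
  by move=> w xw wt; apply: contrapT => fw; apply: nB; exists w.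
have [|m [mt [xm fm]] mmin] := tree_min tr (t := t) (P := fun w => le x w /\ f w <> a).
  by exists w0.
have d0 : 0 < `|f m - a| by rewrite normr_gt0 subr_eq0; apply/eqP.
have lm w : le x w -> lt w m -> f w = a.
  move=> xw wm; apply: contrapT => fw; apply: (tlt_nle tr wm); apply: mmin => //.
  by apply: (tle_trans tr _ mt); case: wm.
have far w : f w = a -> ~ (`|f w - f m| < `|f m - a|).
  by move=> ->; apply/negP; rewrite -leNgt distrC.
have xm' : lt x m by split => // e; apply: fm; rewrite -e.
have [[v vm vP]|mP] := C0_tbelow m Sf d0; last by case: (far _ fx (mP _ xm)).
have xv : le x v by apply: contrapT => nxv; exact: (far _ fx (vP _ xm nxv)).
have [s vs sm] := tsucc_below tr vm.
have vm' : s = m.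
  have [//|sm'] := tle_eqVlt sm; exfalso.
  apply: (far s _ (vP _ sm (tlt_nle tr (proj1 vs)))).
  by apply: lm => //; apply: (tle_trans tr xv); case: vs => -[].
exists v.
  split => //; first by apply: (tle_trans tr _ mt); case: vm.
  by move=> w xw wv; apply: lm => //; exact: (tle_lt_trans tr wv).
move=> w xw wt wP; rewrite vm' in vs; apply: (proj2 vs).
apply: (tnle_lt tr mt wt) => mw; apply: fm; exact: wP.
Qed.

(** Every extension of the level stays in [{|f| >= |a|}], which is covered by finitely many
    [(0, t]]. Run through these [t] and extend as far as possible along each; the final point cannot
    be extended in any direction. *)
Lemma level_end (f : E) x : S f -> f x != 0 ->
  exists u, [/\ le x u, forall w, le x w -> le w u -> f w = f x &
    forall s, tsucc u s -> f s != f x].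
Proof.
move=> Sf fx0; set a := f x in fx0 *.
have a0 : 0 < `|a| by rewrite normr_gt0.
pose A u := le x u /\ forall w, le x w -> le w u -> f w = a.
have Ax : A x by split=> [|w xw wx]; [exact: tle_refl|rewrite (tle_anti tr wx xw)].
have [s sP] := C0_cover Sf a0.
suff [u [Au umax]] : exists u, A u /\
    forall t, t \in s -> forall v, A v -> le u v -> le v t -> v = u.
  exists u; have [xu uP] := Au; split => // r ur; apply/eqP => fr.
  have ru : le u r by case: ur => -[].
  have [|t ts rt] := sP r; first by rewrite fr.
  have Ar : A r.
    split; first exact: (tle_trans tr xu).
    move=> w xw wr; have [->//|wr'] := tle_eqVlt wr.
    by apply: uP => //; apply: (proj2 ur).
  by have := umax t ts r Ar ru rt => rr; case: ur => -[_]; rewrite rr.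
elim: s {sP} => [|t s [u [Au uP]]]; first by exists x.
have [[v [Av uv vt]]|nv] := pselect (exists v, [/\ A v, le u v & le v t]); last first.
  exists u; split => // t'; rewrite inE => /orP[/eqP-> v Av uv vt|]; last exact: uP.
  by case: nv; exists v.
have [xu ua] := Au.
have [|w [uw wt wP] wmax] := level_end_below (a := a) Sf _ (tle_trans tr uv vt).
  by apply: ua => //; exact: tle_refl.
have Aw : A w.
  split; first exact: (tle_trans tr xu).
  move=> z xz zw; have [zu|uz] := tle_total tr zw uw; first exact: ua.
  exact: wP.
exists w; split => // t'; rewrite inE => /orP[/eqP->|t's] z [xz za] wz zt.
  apply: (tle_anti tr) => //; apply: wmax => //; first exact: (tle_trans tr uw).
  by move=> r ur rz; apply: za => //; exact: (tle_trans tr xu).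
have zu : z = u by apply: (uP t') => //; exact: (tle_trans tr uw).
by apply: (tle_anti tr) => //; rewrite zu.
Qed.

(** Take the least [y] such that [f] is [e]-close to [f x] on [[y, x]]. Continuity at [y] extends
    this to some [(v, x]], and minimality of [y] makes it fail at [v]; the jump is from [v] to its
    successor towards [y]. *)
Lemma level_start (f : E) x e : S f -> 0 < e ->
  (forall w, le w x -> `|f w - f x| < e) \/
  exists p : T * T, [/\ tsucc p.1 p.2, le p.2 x,
    forall w, le w x -> ~ le w p.1 -> `|f w - f x| < e & e <= `|f p.1 - f x|].
Proof.
move=> Sf e0.
have [|y [yx yP] ymin] := tree_min tr (t := x)
  (P := fun y => forall w, le y w -> le w x -> `|f w - f x| < e).
  exists x; first exact: tle_refl.
  by move=> w xw wx; rewrite (tle_anti tr wx xw) subrr normr0.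
have ye : 0 < e - `|f y - f x| by rewrite subr_gt0; apply: yP => //; exact: tle_refl.
have near w : `|f w - f y| < e - `|f y - f x| -> `|f w - f x| < e.
  rewrite ltrBrDr => H; apply: le_lt_trans H.
  by rewrite -{1}(subrK (f y) (f w)) -addrA ler_normD.
have [[v vy vP]|yB] := C0_tbelow y Sf ye; last first.
  left=> w wx; have [wy|yw] := tle_total tr wx yx; last exact: yP.
  by apply: near; exact: yB.
have good w : le w x -> ~ le w v -> `|f w - f x| < e.
  move=> wx nwv; have [wy|yw] := tle_total tr wx yx; last exact: yP.
  by apply: near; exact: vP.
right; have [s vs sy] := tsucc_below tr vy.
exists (v, s); split => //=; first exact: (tle_trans tr sy).
rewrite leNgt; apply/negP => fv; apply: (tlt_nle tr vy); apply: ymin.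
  by apply: (tle_trans tr _ yx); case: vy.
move=> w vw wx; have [wv|nwv] := pselect (le w v); last exact: good.
by rewrite (tle_anti tr wv vw).
Qed.

End TreeC0.

(** * Detectors and the bump function *)

(* [lra] does not know absolute values: split on the signs first. *)
Ltac norm_lra :=
  rewrite ?ltr_norml ?ler_norml;
  repeat (match goal with |- context [Num.norm ?x] => case: (ger0P x) => ? end);
  intros; lra.

Section Squares.
Variable R : realDomainType.
Implicit Types z c : R.

Lemma mulrr_normE z : z * z = `|z| * `|z|.
Proof. by rewrite -normrM ger0_norm// -expr2 sqr_ge0. Qed.

Lemma mulrr_le z c : `|z| <= c -> z * z <= c * c.
Proof. by move=> zc; rewrite mulrr_normE ler_pM. Qed.

Lemma mulrr_ge z c : 0 <= c -> c <= `|z| -> c * c <= z * z.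
Proof. by move=> c0 cz; rewrite [leRHS]mulrr_normE ler_pM. Qed.

Lemma mulrr_lt z c : 0 <= c -> z * z < c * c -> `|z| < c.
Proof. by move=> c0; apply: contraTT; rewrite -!leNgt => /mulrr_ge; exact. Qed.

End Squares.

Section Windows.
Variable R : realType.

(* (b, n, k) stands for the window of radius 1/(n+1) and center
   (-1)^b (k+4)/(n+1). *)
Definition window : Type := (bool * nat * nat)%type.
Implicit Types (v : window) (u a : R).

Definition rad v : R := v.1.2.+1%:R^-1.
Definition ctr v : R := (-1) ^+ v.1.1 * ((v.2 + 4)%:R * rad v).

Lemma rad_gt0 v : 0 < rad v. Proof. by rewrite invr_gt0. Qed.

Lemma ctr_far v : 4 * rad v <= `|ctr v|.
Proof.
rewrite normrM normr_sign mul1r ger0_norm ?mulr_ge0 ?(ltW (rad_gt0 v))//.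
by rewrite ler_wpM2r ?(ltW (rad_gt0 v))// ler_nat leq_addl.
Qed.

Lemma window_near a e : a != 0 -> 0 < e -> exists v, rad v < e /\ `|a - ctr v| < rad v.
Proof.
move=> a0 e0; have na0 : 0 < `|a| by rewrite normr_gt0.
(* A radius below [|a| / 4] makes the integer part of [|a| / r] at least [4], so that subtracting
   the offset [4] in the index loses nothing. *)
pose m := Num.min e (`|a| / 4).
have m0 : 0 < m by rewrite lt_min e0 divr_gt0.
pose n := Num.truncn m^-1; pose r : R := n.+1%:R^-1.
have r0 : 0 < r by rewrite invr_gt0.
have rm : r < m.
  by rewrite -[m]invrK ltf_pV2 ?posrE ?invr_gt0// truncnS_gt.
move: rm; rewrite lt_min => /andP[re ra].
have ar : 4 <= `|a| / r by rewrite ler_pdivlMr//; lra.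
have /truncn_itv/andP[k1 k2] : 0 <= `|a| / r by rewrite divr_ge0// ltW.
pose k := Num.truncn (`|a| / r).
have k4 : (4 <= k)%N by rewrite truncn_ge_nat ?divr_ge0// ltW.
exists (a < 0, n, (k - 4)%N); split => //.
rewrite /ctr /rad /= -/r subnK// {1}(realEsign (num_real a)) -mulrBr normrM normr_sign mul1r.
rewrite ler_pdivlMr// in k1; rewrite ltr_pdivrMr// mulrSr mulrDl mul1r in k2.
by rewrite ger0_norm ?subr_ge0// ltrBlDl.
Qed.

(** Squares replace the absolute value, which is not an elementary expression. In units of [rad v],
    [alpha] drops from [1] to [0] between distances [1] and [sqrt 2 < 3/2], and [kappa] rises from
    [0] to [1] between [2] and [sqrt 5 < 5/2]. *)
Definition alpha v u : R := step (2 - (u - ctr v) / rad v * ((u - ctr v) / rad v)).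
Definition kappa v u : R := step ((u - ctr v) / rad v * ((u - ctr v) / rad v) - 4).

Lemma normr_window v u (c : R) : (`|(u - ctr v) / rad v| < c) = (`|u - ctr v| < c * rad v).
Proof.
by rewrite normrM normfV (gtr0_norm (rad_gt0 v)) ltr_pdivrMr// rad_gt0.
Qed.

Lemma alpha_neq0 v u : alpha v u != 0 -> `|u - ctr v| < 3 / 2 * rad v.
Proof.
move=> /step_neq0 H; rewrite -normr_window; apply: mulrr_lt; first lra.
by move: H; move: ((u - ctr v) / rad v) => z; lra.
Qed.

Lemma alpha_eq1 v u : `|u - ctr v| < rad v -> alpha v u = 1.
Proof.
rewrite -[rad v]mul1r -normr_window => H; apply: step_eq1.
have : (u - ctr v) / rad v * ((u - ctr v) / rad v) <= 1 * 1.
  exact/mulrr_le/ltW.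
by move: ((u - ctr v) / rad v) => z; lra.
Qed.

Lemma kappa_neq0 v u : kappa v u != 0 -> 2 * rad v < `|u - ctr v|.
Proof.
move=> /step_neq0 H; rewrite ltNge; apply: contraTN H => H.
have {}H : `|(u - ctr v) / rad v| <= 2.
  by rewrite normrM normfV (gtr0_norm (rad_gt0 v)) ler_pdivrMr// rad_gt0.
by rewrite -leNgt subr_le0 (le_trans (mulrr_le H))//; lra.
Qed.

Lemma kappa_neq1 v u : kappa v u != 1 -> `|u - ctr v| < 5 / 2 * rad v.
Proof.
move=> /step_neq1 H; rewrite -normr_window; apply: mulrr_lt; first lra.
by move: H; move: ((u - ctr v) / rad v) => z; lra.
Qed.

Lemma kappa_eq1 v u : 5 / 2 * rad v <= `|u - ctr v| -> kappa v u = 1.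
Proof.
move=> H; apply/eqP; apply: contraTT H => /kappa_neq1.
by rewrite -ltNge.
Qed.

Lemma alpha_ge0 v u : 0 <= alpha v u. Proof. exact: step_ge0. Qed.
Lemma alpha_le1 v u : alpha v u <= 1. Proof. exact: step_le1. Qed.
Lemma kappa_ge0 v u : 0 <= kappa v u. Proof. exact: step_ge0. Qed.
Lemma kappa_le1 v u : kappa v u <= 1. Proof. exact: step_le1. Qed.

Variables (T : Type) (S : set (T -> R)) (nrm : (T -> R) -> R).
Hypothesis SN : normed_fspace S nrm.

Lemma lexpr_square_window v phi x : lexpr S nrm phi x ->
  lexpr S nrm (fun y => (phi y - ctr v) / rad v * ((phi y - ctr v) / rad v)) x.
Proof.
move=> p; suff H : lexpr S nrm (fun y => (phi y - ctr v) / rad v) x by exact: lexprM.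
apply: lexprM; last exact: lexpr_cst.
by apply: lexprB => //; exact: lexpr_cst.
Qed.

Lemma lexpr_alpha v phi x : S x -> lexpr S nrm phi x -> lexpr S nrm (fun y => alpha v (phi y)) x.
Proof.
move=> Sx p; apply: (lexpr_step SN) => //; apply: lexprB; first exact: lexpr_cst.
exact: lexpr_square_window.
Qed.

Lemma lexpr_kappa v phi x : S x -> lexpr S nrm phi x -> lexpr S nrm (fun y => kappa v (phi y)) x.
Proof.
move=> Sx p; apply: (lexpr_step SN) => //; apply: lexprB; last exact: lexpr_cst.
exact: lexpr_square_window.
Qed.

End Windows.

Section FiniteProducts.
Variables (R : realType) (I : choiceType) (g : I -> R).

Lemma fsprod_neq0 : finite_set [set i | g i != 1] ->
  \big[*%R/1]_(i \in [set: I]) g i != 0 -> forall i, g i != 0.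
Proof.
move=> fg; rewrite prodf_seq_neq0 => /allP H i.
have [->|g1] := eqVneq (g i) 1; first exact: oner_neq0.
apply: (implyP (H i _)) => //; rewrite in_finite_support ?inE.
  by split => //; exact/eqP.
by rewrite setTI; apply: sub_finite_set fg => j /= /eqP.
Qed.

Lemma fsprod_ge0 : (forall i, 0 <= g i) -> 0 <= \big[*%R/1]_(i \in [set: I]) g i.
Proof. by move=> g0; apply: prodr_ge0 => i _; exact: g0. Qed.

Lemma fsprod_le1 : (forall i, 0 <= g i <= 1) -> \big[*%R/1]_(i \in [set: I]) g i <= 1.
Proof. by move=> g01; apply: numdomain.Num.Theory.prodr_ile1 => i _; exact: g01. Qed.

Lemma finite_pos_lb (A : set I) : finite_set A -> (forall i, A i -> 0 < g i) ->
  exists2 c, 0 < c & forall i, A i -> c <= g i.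
Proof.
have seq_lb (s : seq I) : (forall i, i \in s -> 0 < g i) ->
    exists2 c, 0 < c & forall i, i \in s -> c <= g i.
  elim: s => [|i s IH] g0; first by exists 1.
  have [|c c0 cg] := IH; first by move=> j js; apply: g0; rewrite inE js orbT.
  exists (Num.min c (g i)); first by rewrite lt_min c0 g0// mem_head.
  by move=> j; rewrite inE => /orP[/eqP->|/cg H]; rewrite ge_min ?lexx ?H ?orbT.
move=> fA g0; have [|c c0 cg] := seq_lb (fset_set A).
  by move=> i; rewrite in_fset_set// inE; exact: g0.
by exists c => // i Ai; apply: cg; rewrite in_fset_set// inE.
Qed.

End FiniteProducts.

(** * Detectors of level ends and jumps, and the bump function *)

Section Detectors.
Variables (R : realType) (T : choiceType) (le : T -> T -> Prop).
Hypothesis tr : is_tree le.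
Local Notation E := (tree_top le -> R).
Local Notation S := (@C0 R T le).
Local Notation nrm := (@supnorm R T le).
Local Notation tsucc := (tsucc le).
Local Notation lexpr := (lexpr S nrm).
Local Notation lfin := (lfin S nrm).
Local Notation around := (around S nrm).
Let SN := C0_normed_fspace R le.

Lemma around_eval (f : E) (r : R) : S f -> 0 < r ->
  around f (fun g => forall t, `|g t - f t| < r).
Proof.
move=> Sf r0; exists r => // g Sg gr t; apply: le_lt_trans gr.
exact: (supnorm_eval t (nfB SN Sg Sf)).
Qed.

Definition end_det (v : window) (t : T) (f : E) : R :=
  alpha v (f t) *
  \big[*%R/1]_(s \in [set: T]) (if `[< tsucc t s >] then kappa v (f s) else 1).

Definition jump_det (v : window) (p : T * T) (f : E) : R :=
  if `[< tsucc p.1 p.2 >] then alpha v (f p.2) * kappa v (f p.1) else 0.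

(** A factor other than [1] puts [g s] within [5/2] radii of a center at distance at least [4] radii
    from [0]. So [|f s| >= r] for nearby [f], which few successors satisfy. *)
Lemma lfin_tsucc v t (f : E) : S f ->
  lfin (fun s g => (if `[< tsucc t s >] then kappa v (g s) else 1) != 1) f.
Proof.
move=> Sf; have r0 := rad_gt0 R v; set r := rad R v in r0.
exists [set s | tsucc t s /\ r <= `|f s|]; first exact: finite_tsucc_big.
have r1 : 0 < r / 2 by lra.
apply: around_imp (around_eval Sf r1) => g Sg gf s; case: asboolP => [ts|]; last by rewrite eqxx.
move=> /kappa_neq1; rewrite -/r => H; split => //; have := gf s; have := ctr_far R v; rewrite -/r.
by move: H; move: (ctr R v) (g s) (f s) => c a b; norm_lra.
Qed.

Lemma lexpr_end_det v t (f : E) : S f -> lexpr (end_det v t) f.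
Proof.
move=> Sf; apply: lexprM; first by apply: (lexpr_alpha SN) => //; exact: (lexpr_coord S nrm t).
apply: lexpr_fsprod; last exact: lfin_tsucc.
move=> s; case: asboolP => _; last exact: lexpr_cst.
by apply: (lexpr_kappa SN) => //; exact: (lexpr_coord S nrm s).
Qed.

Lemma end_det_neq0 v t (f : E) : S f -> end_det v t f != 0 ->
  `|f t - ctr R v| < 3 / 2 * rad R v /\
  forall s, tsucc t s -> 2 * rad R v < `|f s - ctr R v|.
Proof.
move=> Sf; rewrite mulf_eq0 negb_or => /andP[/alpha_neq0 at0 kt]; split => // s ts.
apply: kappa_neq0; have := fsprod_neq0 (lfin_self SN Sf (lfin_tsucc v t Sf)) kt s.
by case: asboolP.
Qed.

Lemma end_det_eq1 v t (f : E) : `|f t - ctr R v| < rad R v ->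
  (forall s, tsucc t s -> 5 / 2 * rad R v <= `|f s - ctr R v|) -> end_det v t f = 1.
Proof.
move=> ft fs; rewrite /end_det alpha_eq1// mul1r fsbig1// => s _.
by case: asboolP => // /fs /kappa_eq1.
Qed.

Lemma end_det_ge0 v t f : 0 <= end_det v t f.
Proof.
rewrite mulr_ge0 ?alpha_ge0// fsprod_ge0// => s; case: asboolP => // _; exact: kappa_ge0.
Qed.

Lemma end_det_le1 v t f : end_det v t f <= 1.
Proof.
rewrite mulr_ile1 ?alpha_ge0 ?alpha_le1//.
  by apply: fsprod_ge0 => s; case: asboolP => // _; exact: kappa_ge0.
by apply: fsprod_le1 => s; case: asboolP => _; rewrite ?ler01 ?lexx// kappa_ge0 kappa_le1.
Qed.

Lemma lfin_end_det v (f : E) : S f -> lfin (fun t g => end_det v t g != 0) f.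
Proof.
move=> Sf; have r0 := rad_gt0 R v; set r := rad R v in r0.
(* Detection separates [g t] from each [g s] by the gap [2 r - 3/2 r = r / 2]; two perturbations by
   [r / 8] leave [r / 4] for [f]. *)
have r4 : 0 < r / 4 by lra. have r8 : 0 < r / 8 by lra.
exists [set t | r / 4 <= `|f t| /\ forall s, tsucc t s -> r / 4 <= `|f s - f t|].
  exact: finite_ends.
apply: around_imp (around_eval Sf r8) => g Sg gf t /(end_det_neq0 Sg)[]; rewrite -/r => gt gs.
have ft := gf t; have cf := ctr_far R v; rewrite -/r in cf.
split => [|s /gs].
  by move: cf gt ft; move: (ctr R v) (g t) (f t) => c a b; norm_lra.
have fs := gf s; move: cf gt ft fs.
by move: (ctr R v) (g t) (f t) (g s) (f s) => c a b a' b'; norm_lra.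
Qed.

Lemma lexpr_jump_det v p (f : E) : S f -> lexpr (jump_det v p) f.
Proof.
move=> Sf; rewrite /jump_det; case: asboolP => _; last exact: lexpr_cst.
apply: lexprM.
  by apply: (lexpr_alpha SN) => //; exact: (lexpr_coord S nrm p.2).
by apply: (lexpr_kappa SN) => //; exact: (lexpr_coord S nrm p.1).
Qed.

Lemma jump_det_ge0 v p f : 0 <= jump_det v p f.
Proof. by rewrite /jump_det; case: asboolP => // _; rewrite mulr_ge0 ?alpha_ge0 ?kappa_ge0. Qed.

Lemma jump_det_eq1 v p (f : E) : tsucc p.1 p.2 -> `|f p.2 - ctr R v| < rad R v ->
  5 / 2 * rad R v <= `|f p.1 - ctr R v| -> jump_det v p f = 1.
Proof.
move=> ts a1 k1; rewrite /jump_det; case: asboolP => // _.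
by rewrite alpha_eq1// kappa_eq1// mulr1.
Qed.

Lemma lfin_jump_det v (f : E) : S f -> lfin (fun p g => jump_det v p g != 0) f.
Proof.
move=> Sf; have r0 := rad_gt0 R v; set r := rad R v in r0.
have r4 : 0 < r / 4 by lra. have r8 : 0 < r / 8 by lra.
exists [set p : T * T | [/\ tsucc p.1 p.2, r / 4 <= `|f p.2| & r / 4 <= `|f p.2 - f p.1|]].
  exact: finite_jumps.
apply: around_imp (around_eval Sf r8) => g Sg gf p; rewrite /jump_det; case: asboolP; last by rewrite eqxx.
move=> ts; rewrite mulf_eq0 negb_or => /andP[/alpha_neq0 + /kappa_neq0]; rewrite -/r.
have := gf p.1; have := gf p.2; have := ctr_far R v; rewrite -/r /=.
move: (ctr R v) (g p.1) (f p.1) (g p.2) (f p.2) => c a b a' b' h1 h2 h3 h4 h5.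
by split => //; move: h1 h2 h3 h4 h5; norm_lra.
Qed.

(** The margin [4 * rad R v] exceeds the [5/2 * rad R v] needed for [end_det_eq1], so the detector
    keeps the value [1] under small perturbations of [f]. *)
Lemma window_end (f : E) x e : S f -> f x != 0 -> 0 < e -> exists v u,
  [/\ le x u, forall w, le x w -> le w u -> f w = f x, rad R v < e,
   `|f u - ctr R v| < rad R v & forall s, tsucc u s -> 4 * rad R v <= `|f s - ctr R v|].
Proof.
move=> Sf fx0 e0; have [u [xu ufx us]] := level_end tr Sf fx0.
have fu : f u = f x by apply: ufx => //; exact: tle_refl.
have a2 : 0 < `|f x| / 2 by rewrite divr_gt0// normr_gt0.
have [||c c0 cP] := @finite_pos_lb R T (fun s => `|f s - f x|) [set s | tsucc u s /\ `|f x| / 2 <= `|f s|].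
- exact: finite_tsucc_big.
- by move=> s [/us fs _]; rewrite normr_gt0 subr_eq0.
(* [f s] is at distance at least [c] or [|f x| / 2] from [f x]; of these five radii one is spent on
   the distance from [f x] to the center. *)
pose d := Num.min e (Num.min c (`|f x| / 2) / 5).
have d0 : 0 < d by rewrite lt_min e0 divr_gt0// lt_min c0.
have [v [vd av]] := window_near fx0 d0.
move: vd; rewrite lt_min ltr_pdivlMr// lt_min => /andP[ve /andP[vc va]].
exists v, u; split => //; first by rewrite fu.
move=> s us'; have [fs|fs] := leP (`|f x| / 2) `|f s|.
  have := cP s (conj us' fs); move: vc av; move: (ctr R v) (rad R v) (f s) (f x) => q r b a; norm_lra.
by move: va av fs; move: (ctr R v) (rad R v) (f s) (f x) => q r b a; norm_lra.
Qed.

(** Positive exactly when [u * u > 1 - 2 / (n + 4)] and equal to [1] once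
    [u * u >= 1 - 1 / (n + 4)]. The offset [4] keeps the first threshold at least [1/2], so [mu]
    vanishes for [|u| <= 1/2]. *)
Definition mu (n : nat) (u : R) : R := step ((n + 4)%:R * (u * u - 1) + 2).

Definition bump_factor (i : window * T) (f : E) : R :=
  1 - mu (choice.pickle i.1) (f i.2) * end_det i.1 i.2 f.

(* The factor of index (v, t) vanishes when |f t| is close to 1 or larger and
   t is a robust end of a level of f; some factor vanishes as soon as
   |f x| >= 1 for some x. The thresholds in mu increase to 1, so that only
   finitely many factors are active around an f with sup |f| < 1. *)
Definition bump (f : E) : R :=
  if `[< exists t, 1 <= `|f t| >] then 0
  else \big[*%R/1]_(i \in [set: window * T]) bump_factor i f.

Lemma bump_factor01 i f : 0 <= bump_factor i f <= 1.
Proof.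
have me0 : 0 <= mu (choice.pickle i.1) (f i.2) * end_det i.1 i.2 f by rewrite mulr_ge0 ?step_ge0 ?end_det_ge0.
rewrite /bump_factor subr_ge0 lerBlDr lerDl me0 andbT.
by rewrite mulr_ile1 ?step_ge0 ?step_le1 ?end_det_ge0 ?end_det_le1.
Qed.

Lemma bump_ge0 f : 0 <= bump f.
Proof.
rewrite /bump; case: asboolP => // _; apply: fsprod_ge0 => i.
by have /andP[] := bump_factor01 i f.
Qed.

Lemma bump_neq0 f : bump f != 0 -> forall t, `|f t| < 1.
Proof.
rewrite /bump; case: asboolP => [|nt _ t]; first by rewrite eqxx.
by rewrite ltNge; apply/negP => ft; apply: nt; exists t.
Qed.

Lemma bump_center f : (forall t, `|f t| <= 1 / 2) -> bump f = 1.
Proof.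
move=> f2; rewrite /bump; case: asboolP => [[t t1]|_]; first by have := f2 t; lra.
apply: fsbig1 => i _; rewrite /bump_factor (_ : mu _ _ = 0) ?mul0r ?subr0//.
apply/eqP; apply: contraT => /step_neq0; set n := choice.pickle _.
have : f i.2 * f i.2 <= 1 / 2 * (1 / 2).
  exact: mulrr_le.
have : 4 <= (n + 4)%:R :> R by rewrite ler_nat leq_addl.
by move: (f i.2 * f i.2) ((n + 4)%:R) => m k k4 m4; nra.
Qed.

Lemma lexpr_bump_factor i (f : E) : S f -> lexpr (bump_factor i) f.
Proof.
move=> Sf; apply: lexprB; first exact: lexpr_cst.
apply: lexprM; last exact: lexpr_end_det.
have ci : lexpr (fun y => y i.2) f := lexpr_coord S nrm i.2 f.
apply: (lexpr_step SN) => //; apply: lexprD; last exact: lexpr_cst.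
apply: lexprM; first exact: lexpr_cst.
apply: lexprB; last exact: lexpr_cst.
exact: lexprM.
Qed.

Lemma lfin_bump (f : E) : S f -> (forall t, `|f t| < 1) -> lfin (fun i g => bump_factor i g != 1) f.
Proof.
move=> Sf f1; have h0 : 0 < 1 / 2 :> R by lra.
have [M fM M1] := C0_max Sf h0.
have {}M1 : M < 1 by case: M1 => [->|[c ->]] //; lra.
pose m := (M + 1) / 2.
have [m1 r0] : m < 1 /\ 0 < m - M by rewrite /m; split; lra.
have near := around_eval Sf r0.
have [[t0 _]|nt] := pselect (exists t : T, True); last first.
  exists set0 => //; apply: aroundT => g _ [v t] _; apply: nt; by exists t.
have m0 : 0 < m by rewrite /m; have := le_trans (normr_ge0 _) (fM t0); lra.
(* If [|g t| <= m] and [mu n (g t) != 0], then [(n + 4) * (1 - m * m) < 2], which leaves only the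
   windows numbered below [N]. *)
pose N := (Num.truncn (2 / (1 - m * m))).+1.
have mm : 0 < 1 - m * m by nra.
have fn n : (n < N)%N ->
    lfin (fun i g => choice.pickle i.1 = n /\ end_det i.1 i.2 g != 0) f.
  move=> _; have [[v vn]|nv] := pselect (exists v : window, choice.pickle v = n); last first.
    by exists set0 => //; apply: aroundT => g _ [v t] [vn _]; apply: nv; exists v.
  have [A fA AP] := lfin_end_det v Sf.
  exists ((fun t => (v, t)) @` A); first exact: finite_image.
  apply: around_imp AP => g Sg gA [w t] /= [wn wt].
  have wv : w = v by apply: (pcan_inj choice.pickleK); rewrite wn.
  by rewrite wv in wt *; exists t => //; exact: gA.
have [A fA AP] := lfin_lt fn; exists A => //.
apply: around_imp (aroundI near AP) => g Sg [gf gA] [v t] gvt; apply: gA.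
have [mu0 en0] : mu (choice.pickle v) (g t) != 0 /\ end_det v t g != 0.
  split; apply: contraNneq gvt; rewrite /bump_factor /= => ->.
    by rewrite mul0r subr0.
  by rewrite mulr0 subr0.
exists (choice.pickle v) => //=.
move/step_neq0: mu0 => mu0; rewrite ltnS truncn_ge_nat; last by rewrite divr_ge0// ltW.
rewrite ler_pdivlMr//.
have gm : `|g t| <= m.
  have := gf t; have := fM t; move: (g t) (f t) => a b; norm_lra.
have gg : g t * g t <= m * m.
  exact: mulrr_le.
move: mu0 gg; rewrite natrD; have : 0 <= (choice.pickle v)%:R :> R by [].
by move: (_%:R) (g t * g t) (m * m) mm => k z mm' mm'0 k0 mu0 gg; nra.
Qed.

Lemma lexpr_bump (f : E) : S f -> lexpr bump f.
Proof.
move=> Sf; have [[x fx]|nx] := pselect (exists x, 1 <= `|f x|); last first.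
  have f1 t : `|f t| < 1 by rewrite ltNge; apply/negP => ft; apply: nx; exists t.
  have h0 : 0 < 1 / 2 :> R by lra.
  have [M fM M1] := C0_max Sf h0.
  have {}M1 : 0 < 1 - M by rewrite subr_gt0; case: M1 => [->|[c ->]] //; lra.
  apply: lexpr_ext (lexpr_fsprod (fun i => lexpr_bump_factor i Sf) (lfin_bump Sf f1)).
  apply: around_imp (around_eval Sf M1) => g Sg gf; rewrite /bump; case: asboolP => // -[t].
  by have := gf t; have := fM t; move: (g t) (f t) => a b; norm_lra.
apply: lexpr_ext (lexpr_cst S nrm 0 f).
have fx0 : f x != 0 by rewrite -normr_gt0; apply: lt_le_trans fx.
have [v [u [xu ufx _ fu us]]] := window_end Sf fx0 ltr01.
have fux : f u = f x by apply: ufx => //; exact: tle_refl.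
have r0 := rad_gt0 R v; pose n := choice.pickle v.
(* The first two bounds keep [end_det v u g = 1], at [u] and at its successors; the third keeps
   [g u * g u >= 1 - 1 / (n + 4)], where [mu n] equals [1]. So the factor of index [(v, u)] vanishes
   near [f]. *)
pose d := Num.min (rad R v - `|f u - ctr R v|) (Num.min (rad R v) ((n + 4)%:R^-1 / 2)).
have d0 : 0 < d.
  by rewrite !lt_min subr_gt0 fu r0/= divr_gt0// invr_gt0 ltr0n addnS.
apply: around_imp (around_eval Sf d0) => g Sg gf; apply/esym.
rewrite /bump; case: asboolP => // ng.
have g1 t : `|g t| < 1 by rewrite ltNge; apply/negP => gt; apply: ng; exists t.
apply/eqP; apply: contraT => /(fsprod_neq0 (lfin_self SN Sg (lfin_bump Sg g1)))/(_ (v, u)).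
have gd t : [/\ `|g t - f t| < rad R v - `|f u - ctr R v|, `|g t - f t| < rad R v &
    `|g t - f t| < (n + 4)%:R^-1 / 2].
  by have := gf t; rewrite !lt_min => /and3P[].
have en1 : end_det v u g = 1.
  apply: end_det_eq1.
    by have [H _ _] := gd u; move: H; move: (g u) (f u) (ctr R v) (rad R v) => a b c e; norm_lra.
  move=> s /us; have [_ H _] := gd s; move: H r0.
  by move: (g s) (f s) (ctr R v) (rad R v) => a b c e; norm_lra.
have mu1 : mu n (g u) = 1.
  apply: step_eq1; have [_ _ H] := gd u; rewrite fux in H.
  set k : R := (n + 4)%:R in H *.
  have k0 : 0 < k by rewrite ltr0n addnS.
  have kk : k * k^-1 = 1 by rewrite mulfV// gt_eqF.
  have ki : 0 < k^-1 by rewrite invr_gt0.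
  have gu : 1 - k^-1 / 2 <= `|g u| by move: H fx; move: (g u) (f x) (k^-1) => a b c; norm_lra.
  have k4 : k^-1 <= 1 by rewrite invf_le1// ler1n addnS.
  have gg : (1 - k^-1 / 2) * (1 - k^-1 / 2) <= g u * g u by apply: mulrr_ge => //; lra.
  have : k * (- k^-1) <= k * (g u * g u - 1).
    rewrite ler_wpM2l ?(ltW k0)//; have : 0 <= k^-1 * k^-1 by rewrite mulr_ge0// ltW.
    by move: gg; move: (k^-1) (g u * g u) => c z gg c0; lra.
  by rewrite mulrN kk; move: (k * _) => z; lra.
by rewrite (_ : bump_factor (v, u) g = 1 - mu n (g u) * end_det v u g)// en1 mu1 mulr1 subrr eqxx.
Qed.

End Detectors.

(** * Approximation by detected step functions *)

Lemma locally_constant_continuous (R : realType) (X : topologicalType) (f : X -> R) :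
  (forall y, nbhs y [set z | f z = f y]) -> continuous f.
Proof.
move=> fP y; apply/cvgrPdist_lt => e e0; apply: filterS (fP y) => z /= ->.
by rewrite subrr normr0.
Qed.

Section StepFunctions.
Variables (R : realType) (T : choiceType) (le : T -> T -> Prop).
Hypothesis tr : is_tree le.
Local Notation E := (tree_top le -> R).
Local Notation S := (@C0 R T le).
Local Notation nrm := (@supnorm R T le).
Local Notation tsucc := (tsucc le).
Local Notation lexpr := (lexpr S nrm).
Local Notation lfin := (lfin S nrm).
Local Notation around := (around S nrm).
Let SN := C0_normed_fspace R le.

(* (Some (w, (t, s)), (v, u)) encodes the interval (t, u], where s is a
   successor of t, and (None, (v, u)) the interval (0, u]; the windows v and w
   are those in which the detectors see u and (t, s), and the interval carries
   the value ctr v. *)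
Definition piece : Type := (option (window * (T * T)) * (window * T))%type.
Implicit Types (i : piece) (l : seq piece).

Definition piece_set i : set (tree_top le) :=
  [set y | le y i.2.2 /\ if i.1 is Some (_, p) then ~ le y p.1 else True].

(** Pieces may overlap: the first one containing [y] decides. This does no harm in the
    approximation, where each piece is accurate on its whole interval. *)
Fixpoint step_fun l (y : tree_top le) : R :=
  if l is i :: l' then if `[< piece_set i y >] then ctr R i.2.1 else step_fun l' y
  else 0.

Definition piece_det i (f : E) : R :=
  (if i.1 is Some (w, p) then jump_det w p f else 1) * end_det i.2.1 i.2.2 f.

Definition step_det l (f : E) : R := \prod_(i <- l) piece_det i f.

(** The part of a piece that ranges over a countable type. Once it is fixed, the detectors of the
    remaining data form a locally finite family. *)
Definition piece_windows i : option window * window := (omap fst i.1, i.2.1).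

Lemma piece_set_open i : open (piece_set i).
Proof.
have -> : piece_set i = [set y | le y i.2.2] `&`
    (if i.1 is Some (_, p) then ~` [set y | le y p.1] else setT).
  by case: i => [[[w p]|] [v u]]; apply/seteqP; split.
apply: openI; first exact: open_tle.
case: i.1 => [[w p]|]; last exact: openT.
by rewrite openC; exact: closed_tle.
Qed.

Lemma piece_set_closed i : closed (piece_set i).
Proof.
have -> : piece_set i = [set y | le y i.2.2] `&`
    (if i.1 is Some (_, p) then ~` [set y | le y p.1] else setT).
  by case: i => [[[w p]|] [v u]]; apply/seteqP; split.
apply: closedI; first exact: closed_tle.
case: i.1 => [[w p]|]; last exact: closedT.
by rewrite closedC; exact: open_tle.
Qed.

Lemma step_fun_locally_constant l y : nbhs y [set z | step_fun l z = step_fun l y].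
Proof.
elim: l => [|i l IH]; first exact: filterE.
have [yi|yi] := pselect (piece_set i y).
  apply: filterS (open_nbhs_nbhs (conj (piece_set_open i) yi)) => z zi /=.
  by rewrite !asboolT.
have oi : open (~` piece_set i) by rewrite openC; exact: piece_set_closed.
apply: filterS2 (open_nbhs_nbhs (conj oi yi)) IH => z zi zl /=.
by rewrite !asboolF.
Qed.

Lemma step_fun_C0 l : S (step_fun l).
Proof.
have [K cK Kl] : exists2 K : set (tree_top le), compact K &
    forall y, step_fun l y != 0 -> K y.
  elim: l => [|i l [K cK Kl]] /=.
    by exists set0; [exact: compact0|move=> y; rewrite eqxx].
  exists ([set s | le s i.2.2] `|` K); first by apply: compactU => //; exact: compact_tle.
  by move=> y; case: asboolP => [[yi _] _|_ /Kl]; [left|right].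
apply: (@C0_sub _ _ _ _ (fun=> K)).
  exact/locally_constant_continuous/step_fun_locally_constant.
move=> e e0; split => // y /= ey; apply: Kl.
by rewrite -normr_gt0; exact: lt_le_trans ey.
Qed.

Lemma lexpr_step_det l (f : E) : S f -> lexpr (step_det l) f.
Proof.
move=> Sf; apply: lexpr_prod => i; apply: lexprM; last exact: lexpr_end_det.
case: i.1 => [[w p]|]; first exact: lexpr_jump_det.
exact: lexpr_cst.
Qed.

Lemma piece_det_ge0 i f : 0 <= piece_det i f.
Proof.
rewrite mulr_ge0 ?end_det_ge0//.
by case: i.1 => [[w p]|] //; exact: jump_det_ge0.
Qed.

Lemma lfin_piece_det c (f : E) : S f ->
  lfin (fun i g => piece_windows i = c /\ piece_det i g != 0) f.
Proof.
case: c => [[w|] v] Sf; have [A fA AP] := lfin_end_det tr v Sf.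
  have [B fB BP] := lfin_jump_det tr w Sf.
  exists ((fun q : (T * T) * T => (Some (w, q.1), (v, q.2)) : piece) @` (B `*` A)).
    by apply: finite_image; exact: finite_setX.
  apply: around_imp (aroundI AP BP) => g Sg [gA gB] [[[w' p]|] [v' u]] [] //.
  move=> [-> ->]; rewrite /piece_det /= mulf_eq0 negb_or => /andP[/gB Bp /gA Au].
  by exists (p, u).
exists ((fun u : T => (None, (v, u)) : piece) @` A); first exact: finite_image.
apply: around_imp AP => g Sg gA [[[w' p]|] [v' u]] [] // [->].
by rewrite /piece_det /= mul1r => /gA Au; exists u.
Qed.

Lemma lfin_step_det cs (f : E) : S f ->
  lfin (fun l g => map piece_windows l = cs /\ step_det l g != 0) f.
Proof.
move=> Sf; elim: cs => [|c cs [A fA AP]].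
  exists [set [::]]; first exact: finite_set1.
  by apply: aroundT => g _ [|i l] [].
have [B fB BP] := lfin_piece_det c Sf.
exists ((fun q : piece * seq piece => q.1 :: q.2) @` (B `*` A)).
  by apply: finite_image; exact: finite_setX.
apply: around_imp (aroundI AP BP) => g Sg [gA gB] [|i l] [] //= [ic lc].
rewrite /step_det big_cons mulf_eq0 negb_or => /andP[gi gl].
by exists (i, l) => //; split; [exact: gB|exact: gA].
Qed.

(** The upper end comes from [window_end] and the lower one from [level_start]. Half of the error is
    the variation of [f] on the interval, half the distance from [f u] to the center. *)
Lemma piece_approx (f : E) x e : S f -> 0 < e -> e <= `|f x| ->
  exists i, [/\ piece_set i x, piece_det i f = 1 &
    forall y, piece_set i y -> `|f y - ctr R i.2.1| <= e].
Proof.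
move=> Sf e0 ex; have fx0 : f x != 0 by rewrite -normr_gt0; exact: lt_le_trans ex.
have e2 : 0 < e / 2 by lra.
have [v [u [xu fu ve fuv us]]] := window_end tr Sf fx0 e2.
have fux : f u = f x by apply: fu => //; exact: tle_refl.
have en1 : end_det v u f = 1.
  apply: end_det_eq1 => // s /us; have := rad_gt0 R v; lra.
have close y : `|f y - f x| < e / 2 -> `|f y - ctr R v| <= e.
  move=> yx; rewrite -fux in yx; rewrite -(subrK (f u) (f y)) -addrA.
  by rewrite ltW// (splitr e) (le_lt_trans (ler_normD _ _))// ltrD// (lt_trans fuv).
have [low|[[t s] [/= ts sx low ft]]] := level_start tr x Sf e2.
  exists (None, (v, u)); split => //=; first by rewrite /piece_det /= mul1r.
  move=> y [yu _]; apply: close; have [yx|xy] := tle_total tr yu xu; first exact: low.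
  by rewrite fu// subrr normr0.
have fsx : `|f s - f x| < e / 2 by apply: low => //; apply: (tlt_nle tr); case: ts.
have fs0 : f s != 0 by rewrite -normr_gt0; move: ex fsx e0; norm_lra.
(* The jump is genuine since [f s] is closer to [f x] than [f t] is. A window at [f s] with radius
   below a quarter of the jump leaves [f t] more than [3] radii from the center. *)
have fts : 0 < `|f t - f s| / 4 by move: ft fsx; norm_lra.
have [w [wt ws]] := window_near fs0 fts.
have lo1 : jump_det w (t, s) f = 1.
  apply: jump_det_eq1 => //=; move: wt ws (rad_gt0 R w).
  by move: (f t) (f s) (ctr R w) (rad R w) => a b c r; norm_lra.
exists (Some (w, (t, s)), (v, u)); split => /=.
- split => //= xt; apply: (tlt_nle tr (proj1 ts)); exact: (tle_trans tr sx).
- by rewrite /piece_det /= lo1 en1 mulr1.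
- move=> y [/= yu nyt]; apply: close; have [yx|xy] := tle_total tr yu xu; first exact: low.
  by rewrite fu// subrr normr0.
Qed.

Lemma step_fun_approx (f : E) e : S f -> 0 < e ->
  exists2 l, 0 < step_det l f & nrm (f - step_fun l) <= e.
Proof.
move=> Sf e0.
pose good i := piece_det i f = 1 /\ forall y, piece_set i y -> `|f y - ctr R i.2.1| <= e.
have [||s sP] := @compact_seq_cover _ [set t : tree_top le | e <= `|f t|] piece
    (fun i => if `[< good i >] then piece_set i else set0) (proj2 Sf e e0).
(* Emptying the sets of the other pieces forces the finite cover to use good pieces. *)
- by move=> i; case: asboolP => _; [exact: piece_set_open|exact: open0].
- move=> x /(piece_approx Sf e0)[i [xi i1 ie]]; exists i; case: asboolP => // -[].
  by split.
pose l := [seq i <- s | `[< good i >]].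
have lgood i : i \in l -> good i by rewrite mem_filter => /andP[/asboolP].
exists l.
  rewrite /step_det big_seq; apply: prodr_gt0 => i /lgood[-> _].
  exact: ltr01.
apply: supnorm_le => [|y]; first exact: ltW.
rewrite (_ : (f - step_fun l) y = f y - step_fun l y)//.
have : e <= `|f y| -> exists2 i, i \in l & piece_set i y.
  move=> /sP[i is_]; case: asboolP => // gi yi; exists i => //.
  by rewrite mem_filter is_ andbT; apply/asboolP.
elim: l lgood => [|i l IH] lgood ly /=.
  by rewrite subr0 leNgt; apply/negP => /ltW /ly[].
case: asboolP => yi; first by have [_] := lgood i (mem_head _ _); exact.
apply: IH => [j jl|/ly[j]]; first by apply: lgood; rewrite inE jl orbT.
by rewrite inE => /orP[/eqP->//|jl yj]; exists j.
Qed.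

End StepFunctions.

(** * Scaled bumps centered at step functions *)

Theorem theorem9p4 (R : realType) (T : choiceType) (le : T -> T -> Prop) :
  is_tree le ->
  forall UU : set (set (tree_top le -> R)),
    (forall U, UU U -> nopen (@C0 R T le) (@supnorm R T le) U) ->
    @C0 R T le `<=` \bigcup_(U in UU) U ->
    exists (J : choiceType) (phi : J -> (tree_top le -> R) -> R),
      smooth_pou_subordinate (@C0 R T le) (@supnorm R T le) UU phi.
Proof.
move=> tr UU oU cU; have SN := C0_normed_fspace R le.
pose S := @C0 R T le; pose nrm := @supnorm R T le.
(* For [j = (l, k)] the bump lives in the ball of radius [1 / (k + 1)] around [step_fun R l]. Asking
   for twice that radius inside [U] takes care of the closure of the support; the other indices get
   the zero function. *)
pose inside (j : seq (piece T) * nat) : Prop := exists2 U, UU U & forall y, S y ->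
  nrm (y - step_fun R j.1) < 2 / j.2.+1%:R -> U y.
pose phi (j : seq (piece T) * nat) (f : tree_top le -> R) : R :=
  if `[< inside j >] then step_det j.1 f * bump (j.2.+1%:R *: (f - step_fun R j.1)) else 0.
(* The layer of [j] encodes its countable data, the windows of the pieces and the scale; local
   finiteness within a layer is [lfin_step_det]. *)
pose n (j : seq (piece T) * nat) : nat := choice.pickle (map (@piece_windows T) j.1, j.2).
have Sz l : S (step_fun R l) by exact: step_fun_C0.
have phi_det j f : phi j f != 0 -> step_det j.1 f != 0.
  by rewrite /phi; case: asboolP => [_|]; rewrite ?eqxx// mulf_eq0 negb_or => /andP[].
exists (seq (piece T) * nat)%type; apply: (@partition_assembly _ _ _ _ SN _ n phi).
- move=> [l k] f Sf; rewrite /phi; case: asboolP => _; last exact: lexpr_cst.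
  apply: lexprM; first exact: lexpr_step_det.
  apply: (lexpr_affine SN (phi := @bump R T le)) => //; first exact: Sz.
  apply: lexpr_bump => //; apply: (nfZ SN); apply: (nfB SN) => //; exact: Sz.
- move=> [l k] f Sf; rewrite /phi; case: asboolP => // _.
  by rewrite mulr_ge0 ?bump_ge0// prodr_ge0// => i _; exact: piece_det_ge0.
- move=> m f Sf.
  have [[[cs k] csm]|nm] := pselect (exists c : seq (option window * window) * nat,
    choice.pickle c = m); last first.
    exists set0 => //; apply: aroundT => g _ j [jm _].
    by apply: nm; exists (map (@piece_windows T) j.1, j.2).
  have [A fA AP] := lfin_step_det tr cs Sf.
  exists ((fun l => (l, k)) @` A); first exact: finite_image.
  apply: around_imp AP => g Sg gA [l k'] [jm /phi_det pl].
  have [lcs ->] : (map (@piece_windows T) l, k') = (cs, k).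
    by apply: (pcan_inj choice.pickleK); rewrite csm.
  by exists l => //; apply: gA.
- move=> f Sf; have [U UUU Uf] := cU f Sf.
  have [_ /(_ f Uf)[r r0 rU]] := oU U UUU.
  (* Approximating [f] within [1 / (2 K)] puts the rescaled difference where [bump] is [1], and a
     point within [2 / K] of the step function is within [5 / (2 K) < 3 / K < r] of [f]. *)
  pose k := Num.truncn (3 / r); set K : R := k.+1%:R.
  have K0 : 0 < K by rewrite ltr0n.
  have Kr : 3 / K < r by rewrite ltr_pdivrMr// mulrC -ltr_pdivrMr// truncnS_gt.
  have e0 : 0 < 1 / 2 / K by rewrite !divr_gt0.
  have [l ld lf] := step_fun_approx tr Sf e0.
  exists (l, k); rewrite /phi; case: asboolP => [_|[]] /=.
    rewrite mulf_neq0 ?gt_eqF// bump_center// => t.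
    apply: le_trans (nf_eval SN t _) _; first exact: (nfZ SN _ (nfB SN Sf (Sz l))).
    rewrite (nf_nrmZ SN _ (nfB SN Sf (Sz l))).
    by rewrite gtr0_norm// mulrC -ler_pdivlMr.
  exists U => // y Sy /= yz; apply: rU => //; apply: lt_trans Kr.
  apply: le_lt_trans (nrm_dist3 SN Sy Sf (Sz l)) _; rewrite -/nrm [X in _ + X](nrmBC SN (Sz l) Sf).
  have -> : 3 / K = 2 / K + (1 / 2 / K + 1 / 2 / K) by field; rewrite gt_eqF.
  by apply: ltr_leD => //; apply: le_trans lf _; rewrite lerDl ltW.
- move=> [l k]; have [[U UUU jU]|nj] := pselect (inside (l, k)).
    exists U => // x [Sx xcl]; apply: jU => //=.
    have K0 : 0 < k.+1%:R :> R by [].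
    have e0 : 0 < 1 / k.+1%:R :> R by rewrite divr_gt0.
    have [y [Sy py] yx] := xcl _ e0.
    apply: le_lt_trans (nrm_dist3 SN Sx (Sz l) Sy) _.
    have -> : 2 / k.+1%:R = 1 / k.+1%:R + 1 / k.+1%:R :> R by field; rewrite addr_eq0; lra.
    apply: ltr_leD; first by rewrite (nrmBC SN Sx Sy).
    move: py; rewrite /phi; case: asboolP => [_|]; rewrite ?eqxx// mulf_eq0 negb_or.
    move=> /andP[_ /bump_neq0 b1]; rewrite ler_pdivlMr//.
    rewrite -(gtr0_norm K0) mulrC -(nf_nrmZ SN _ (nfB SN Sy (Sz l))).
    by apply: supnorm_le => // t; rewrite ltW.
  (* Here [phi (l, k)] vanishes identically, so any member of the cover will do; one exists because
     [0] is covered. *)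
  have [U UUU _] := cU 0 (nf0 SN); exists U => // x [Sx /(_ 1 ltr01)[y [_]]].
  by rewrite /phi; case: asboolP => //; rewrite eqxx.
Qed.
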